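(* Let $\Omega$ be a bounded convex set in $\mathbb{R}^n$ with non-empty interior, and let $\chi_\Omega$ be its characteristic function. The Gauss--Weierstrass integral $$W\chi_\Omega(x,t) = \frac{1}{(4\pi t)^{n/2}}\int_{\mathbb{R}^n} \exp\left(-\frac{|x-y|^2}{4t}\right)\chi_\Omega(y)\,\mathrm{d}y,\quad (x,t)\in\mathbb{R}^n\times(0,+\infty),$$ is strictly $1/2$-parabolically quasi-concave on $\mathbb{R}^n\times(0,+\infty)$.
   Context: For $t_0,t_1>0$ and $\lambda\in[0,1]$ put $M_{1/2}(t_0,t_1;\lambda) = ((1-\lambda)\sqrt{t_0}+\lambda\sqrt{t_1})^2$, and write $x_\lambda=(1-\lambda)x_0+\lambda x_1$. A non-negative function $\varphi$ on $\mathbb{R}^n\times(0,+\infty)$ is $1/2$-parabolically quasi-concave if for all $(x_0,t_0),(x_1,t_1)\in\mathbb{R}^n\times(0,+\infty)$ and $\lambda\in[0,1]$, $$( * )\quad \varphi(x_\lambda, M_{1/2}(t_0,t_1;\lambda)) \geq M_{-\infty}(\varphi(x_0,t_0),\varphi(x_1,t_1);\lambda),$$ where $M_{-\infty}(a,b;\lambda)=\min\{a,b\}$ for $a,b\ge 0$. It is strictly $1/2$-parabolically quasi-concave if moreover equality in $( * )$ holds if and only if $(x_0,t_0)=(x_1,t_1)$ or $\lambda=0$ or $\lambda=1$ — with the convention of the next sentence. Convention: for the strict notion, ''equality only if'' is the essential requirement; when $\varphi(x_0,t_0)\neq\varphi(x_1,t_1)$ and $\lambda\in\{0,1\}$ the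 value of the left-hand side is simply $\varphi$ at an endpoint, so strictness means precisely that $( * )$ is a strict inequality for all distinct $(x_0,t_0),(x_1,t_1)$ and all $\lambda\in(0,1)$. *)

(* Defs.v *)
From HB Require Import structures.
From mathcomp Require Import all_boot all_order all_algebra.
From mathcomp Require Import all_classical all_reals all_analysis.

Set Implicit Arguments.
Unset Strict Implicit.
Unset Printing Implicit Defensive.

Import Order.TTheory GRing.Theory Num.Theory.
Import numFieldNormedType.Exports.

Local Open Scope classical_set_scope.
Local Open Scope ring_scope.

(* Points of R^n are row vectors 'rV[R]_n, which carry the library's topology
   (that of the sup norm).  The library equips n.-tuple R, not 'rV[R]_n, with
   the product sigma-algebra, so Lebesgue measure lives on n.-tuple R and
   row_of_tuple is the identification of the two. *)

Section lebesgue_measure_Rn.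
Context {R : realType}.

Definition row_of_tuple n (y : n.-tuple R) : 'rV[R]_n := \row_i tnth y i.

Section step.
Context {n : nat} (mu : {sigma_finite_measure set (n.-tuple R) -> \bar R}).

Definition tuple_of_pair (p : measurableTypeR R * n.-tuple R) : n.+1.-tuple R :=
  [tuple of p.1 :: p.2].

Lemma measurable_tuple_of_pair : measurable_fun setT tuple_of_pair.
Proof. exact: measurable_cons. Qed.

Definition lebesgue_step : set (n.+1.-tuple R) -> \bar R :=
  pushforward (lebesgue_measure \x mu)%E tuple_of_pair.

Let lebesgue_step0 : lebesgue_step set0 = 0%E.
Proof. by rewrite /lebesgue_step /pushforward preimage_set0 measure0. Qed.

Let lebesgue_step_ge0 A : (0 <= lebesgue_step A)%E.
Proof. by rewrite /lebesgue_step /pushforward measure_ge0. Qed.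

Let lebesgue_step_sigma_additive : semi_sigma_additive lebesgue_step.
Proof.
move=> F mF tF mUF; rewrite /lebesgue_step /pushforward preimage_bigcup.
apply: measure_semi_sigma_additive.
- by move=> i; rewrite -[X in measurable X]setTI; exact: measurable_tuple_of_pair.
- apply/trivIsetP => /= i j _ _ ij; rewrite -preimage_setI.
  by move/trivIsetP : tF => /(_ _ _ _ _ ij) ->//; rewrite preimage_set0.
- rewrite -preimage_bigcup -[X in measurable X]setTI.
  exact: measurable_tuple_of_pair.
Qed.

HB.instance Definition _ := isMeasure.Build _ _ _ lebesgue_step
  lebesgue_step0 lebesgue_step_ge0 lebesgue_step_sigma_additive.

Let lebesgue_step_sigma_finite : sigma_finite setT lebesgue_step.
Proof.
have /sigma_finiteP[F [FT ndF Foo]] := sigma_finiteT (@lebesgue_measure R).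
have /sigma_finiteP[G [GT ndG Goo]] := sigma_finiteT mu.
pose g (v : n.+1.-tuple R) : measurableTypeR R * n.-tuple R :=
  (thead v, [tuple of behead v]).
have gK : cancel tuple_of_pair g.
  by case=> x y; congr pair; apply/val_inj.
have hK : cancel g tuple_of_pair.
  by move=> v; rewrite /tuple_of_pair/= [RHS]tuple_eta.
have mg : measurable_fun setT g.
  apply: measurable_fun_pair; last exact: measurable_behead.
  exact: (@measurable_tnth _ _ _ ord0).
exists (fun k => g @^-1` (F k `*` G k)) => [|k].
  rewrite -preimage_bigcup -[LHS](preimage_setT g); congr (_ @^-1` _).
  rewrite -setXTT FT GT predeqE => -[x y]; split=> [[/= [i _ Fx] [j _ Gy]]|].
    exists (maxn i j) => //; split.
    - by move: x Fx; exact/subsetPset/ndF/leq_maxl.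
    - by move: y Gy; exact/subsetPset/ndG/leq_maxr.
  by move=> [i _ []/= ? ?]; split; exists i.
have [mF Fk] := Foo k; have [mG Gk] := Goo k; split.
  by rewrite -[X in measurable X]setTI; apply: mg => //; exact: measurableX.
rewrite /lebesgue_step /pushforward -comp_preimage.
rewrite (_ : g \o tuple_of_pair = id); last exact/funext.
by rewrite preimage_id product_measure1E// lte_mul_pinfty// ge0_fin_numE.
Qed.

HB.instance Definition _ := Measure_isSigmaFinite.Build _ _ _ lebesgue_step
  lebesgue_step_sigma_finite.

End step.

(* n-fold product of the one-dimensional Lebesgue measure, on Borel sets *)
Fixpoint borel_lebesgue n : {sigma_finite_measure set (n.-tuple R) -> \bar R} :=
  match n with
  | 0 => \d_[tuple]
  | n'.+1 => lebesgue_step (borel_lebesgue n')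
  end.

(* Its Caratheodory completion, i.e. Lebesgue measure on the sigma-algebra of
   Lebesgue measurable sets: a bounded convex set need not be Borel. *)
Definition lebesgue_Rn n :=
  @completed_measure_extension _ _ _ (borel_lebesgue n).
Arguments lebesgue_Rn n : clear implicits.

HB.instance Definition _ n := Measure.on (lebesgue_Rn n).

End lebesgue_measure_Rn.
Arguments lebesgue_Rn {R} n.

Section parabolic_quasi_concavity.
Context {R : realType}.

Definition eucl_norm n (x : 'rV[R]_n) : R := Num.sqrt (\sum_i x ord0 i ^+ 2).

Definition gauss_weierstrass n (f : 'rV[R]_n -> R) (x : 'rV[R]_n) (t : R) : R :=
  ((4 * pi * t) `^ (n%:R / 2))^-1 *
  \int[lebesgue_Rn n]_y
    (expR (- (eucl_norm (x - row_of_tuple y) ^+ 2 / (4 * t))) *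
     f (row_of_tuple y)).

(* M_{1/2}(t0, t1; l) *)
Definition mean_half (t0 t1 l : R) : R :=
  ((1 - l) * Num.sqrt t0 + l * Num.sqrt t1) ^+ 2.

(* A function on R^n x (0, +oo) is represented by a total
   phi : 'rV[R]_n -> R -> R, of which only the values at t > 0 are used. *)
Definition half_parabolically_quasi_concave n (phi : 'rV[R]_n -> R -> R) : Prop :=
  (forall x t, 0 < t -> 0 <= phi x t) /\
  (forall (x0 x1 : 'rV[R]_n) (t0 t1 l : R),
    0 < t0 -> 0 < t1 -> 0 <= l <= 1 ->
    Num.min (phi x0 t0) (phi x1 t1) <=
      phi ((1 - l) *: x0 + l *: x1) (mean_half t0 t1 l)).

Definition strictly_half_parabolically_quasi_concave n
    (phi : 'rV[R]_n -> R -> R) : Prop :=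
  half_parabolically_quasi_concave phi /\
  (forall (x0 x1 : 'rV[R]_n) (t0 t1 l : R),
    0 < t0 -> 0 < t1 -> 0 < l < 1 -> (x0, t0) <> (x1, t1) ->
    Num.min (phi x0 t0) (phi x1 t1) <
      phi ((1 - l) *: x0 + l *: x1) (mean_half t0 t1 l)).

End parabolic_quasi_concavity.

(* Main.v *)
Require Import Defs.
From mathcomp Require Import all_boot all_order all_algebra.
From mathcomp Require Import all_classical all_reals all_analysis.
From mathcomp Require Import measurable_realfun lra ring.

(* With s = sqrt t, the value at (x, t) is, up to a constant, the Gaussian mass
   of the rescaled body (Omega - x) / s.  Prekopa-Leindler bounds the mass at the
   intermediate point below by a weighted geometric mean of the masses at the
   ends, hence by their minimum.  For strictness: if (x0, s0) <> (x1, s1), the two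
   rescaled bodies have different support numbers in some direction +-e_j, so
   cutting each of them orthogonally to e_j, with the same proportion of mass
   above, can be done so that the upper parts are separated by a slab.  On the
   upper parts the strict convexity of the square norm gains a factor > 1 in
   Prekopa-Leindler, and adding the estimate for the lower parts gives a strict
   inequality. *)

Import Order.TTheory GRing.Theory Num.Theory.
Import numFieldNormedType.Exports.

Local Open Scope classical_set_scope.
Local Open Scope ring_scope.

Set Implicit Arguments.
Unset Strict Implicit.
Unset Printing Implicit Defensive.

(** * The one-dimensional Prekopa-Leindler inequality *)

Section minkowski_1d.
Context {R : realType}.
Implicit Types (A B C : set (measurableTypeR R)).
Local Notation mu := (@lebesgue_measure R).

(** The mean of times is the one for which [s] averages linearly: with a = 1 - l and b = l, the
    intermediate point has s = a s0 + b s1 and x = a x0 + b x1. Put p = a s0 / s and q = b s1 / s.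
    Then p + q = 1 and (a y + b z - x) / s = p (y - x0) / s0 + q (z - x1) / s1, so by convexity the
    intermediate rescaled body contains the p, q combination of the two others. Hence the exponents
    p, q differ from the coefficients a, b that act on the unscaled points.

    The equality cases of Prekopa-Leindler are delicate; the cuts avoid them. With the same
    proportion th above on both sides, the two parts contribute th G and (1 - th) G, where G is the
    weighted geometric mean. These add up to G exactly, so a factor > 1 on one part survives in the
    sum.

    Two opposite support numbers of (Omega - x) / s add up to a width of Omega divided by s, which
    determines s; a single one then determines a coordinate of x.

    Since Omega may fail to be Borel, its integral is squeezed between those over its interior and
    its closure, which agree. *)

Definition affine (a c : R) : measurableTypeR R -> measurableTypeR R :=
  fun x => a * x + c.

Lemma measurable_affine (a c : R) : measurable_fun setT (affine a c).
Proof.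
apply: (@measurable_funD _ (measurableTypeR R) R); last exact: measurable_cst.
exact: (measurable_funM (measurable_cst _) (@measurable_id _ _ _)).
Qed.

Lemma measurable_preimage_affine (a c : R) A : measurable A ->
  measurable (affine a c @^-1` A).
Proof.
move=> mA; rewrite -[X in measurable X]setTI.
exact: measurable_affine.
Qed.

(** By uniqueness of Lebesgue measure: [a] times the pushforward under the affine map has the right
    value on half-open intervals. *)
Lemma lebesgue_measure_affine (a c : R) A : 0 < a -> measurable A ->
  mu (affine a c @^-1` A) = (a^-1%:E * mu A)%E.
Proof.
move=> a0 mA; have a0' := ltW a0.
have [m mE] : exists m : {measure set (measurableTypeR R) -> \bar R},
    forall A, m A = mu (affine a c @^-1` A).
  by unshelve eexists (pushforward mu (affine a c)); [exact: measurable_affine|].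
pose m' : {measure set (measurableTypeR R) -> \bar R} := mscale (NngNum a0') m.
have msE B : m' B = (a%:E * mu (affine a c @^-1` B))%E by rewrite -mE.
have -> : mu A = m' A.
  apply: lebesgue_measure_unique => // _ [[x y] _ <-]; rewrite msE.
  have -> : affine a c @^-1` `]x, y] = `](x - c) / a, (y - c) / a]%classic.
    apply/seteqP; split => z /=; rewrite /affine !in_itv/= ltr_pdivrMr// ler_pdivlMr//
      ltrBlDr lerBrDr mulrC//.
  rewrite !lebesgue_measure_itv/= !lte_fin ltr_pM2r ?invr_gt0// ltrD2r.
  case: ifP => _; last by rewrite mule0.
  rewrite -!EFinD -EFinM; congr EFin; field; exact: lt0r_neq0.
rewrite msE muleA -EFinM mulVf ?mul1e//; exact: lt0r_neq0.
Qed.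

(** For [x] in A near sup A and [y] in B near inf B, the translates aA + by and ax + bB both lie in
    C. The first ends about where the second begins, so they overlap only inside a short
    interval. *)
Lemma lebesgue_measure_minkowski (a b c : R) A B C : 0 < a -> 0 < b ->
  measurable A -> measurable B -> measurable C ->
  A !=set0 -> B !=set0 ->
  (forall x, A x -> `|x| <= c) -> (forall x, B x -> `|x| <= c) ->
  (forall x y, A x -> B y -> C (a * x + b * y)) ->
  (a%:E * mu A + b%:E * mu B <= mu C)%E.
Proof.
move=> a0 b0 mA mB mC A0 B0 Ac Bc ABC.
have [an0 bn0] : a != 0 /\ b != 0 by rewrite !gt_eqF.
have hA : has_sup A by split=> //; exists c => x /Ac; apply: le_trans; exact: ler_norm.
have hB : has_inf B.
  by split=> //; exists (- c) => x /Bc; rewrite ler_norml => /andP[].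
apply/lee_addgt0Pr => e e0.
have ab0 : 0 < a + b by rewrite addr_gt0.
(* This slack at both [x] and [y] makes the overlap interval [I] have length at most a e / (a + b) +
   b e / (a + b) = e. *)
have ee0 : 0 < e / (a + b) by rewrite divr_gt0.
have [x Ax xM] := sup_adherent ee0 hA.
have [y By ym] := inf_adherent ee0 hB.
have xM' := ub_le_sup hA.2 Ax.
have ym' := ge_inf hB.2 By.
(* [P] is aA + by and [Q] is ax + bB, written as preimages to get measurability and measure at
   once. *)
pose P := affine a^-1 (- (b * y / a)) @^-1` A.
pose Q := affine b^-1 (- (a * x / b)) @^-1` B.
pose I : set (measurableTypeR R) := `[a * x + b * inf B, a * sup A + b * y]%classic.
have mP : measurable P by exact: measurable_preimage_affine.
have mQ : measurable Q by exact: measurable_preimage_affine.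
have mI : measurable I by exact: measurable_itv.
have <- : mu P = (a%:E * mu A)%E by rewrite lebesgue_measure_affine ?invr_gt0// invrK.
have <- : mu Q = (b%:E * mu B)%E by rewrite lebesgue_measure_affine ?invr_gt0// invrK.
have QI : (mu Q <= mu (Q `\` I) + mu I)%E.
  rewrite (le_trans _ (measureU2 _ _ _))//; last exact: measurableD.
  apply: le_measure; rewrite ?inE//; first by apply: measurableU => //; exact: measurableD.
  by move=> z Qz; have [Iz|Iz] := pselect (I z); [right|left].
have PC z : P z -> C z.
  move=> /ABC /(_ By); rewrite /affine; suff -> : a * (a^-1 * z + - (b * y / a)) + b * y = z by [].
  by field.
have QC z : Q z -> C z.
  move=> /(ABC _ _ Ax); rewrite /affine; suff -> : a * x + b * (b^-1 * z + - (a * x / b)) = z by [].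
  by field.
have PQI : P `&` (Q `\` I) = set0.
  apply/seteqP; split=> // z [Pz [Qz]]; apply.
  have /= := ub_le_sup hA.2 Pz; have /= := ge_inf hB.2 Qz.
  rewrite /affine /I/= in_itv/= => h1 h2; apply/andP; split.
    rewrite -(ler_pM2l b0) in h1.
    have -> : z = a * x + b * (b^-1 * z - a * x / b) by field.
    by rewrite lerD2l.
  rewrite -(ler_pM2l a0) in h2.
  have -> : z = a * (a^-1 * z - b * y / a) + b * y by field.
  by rewrite lerD2r.
have muI : (mu I <= e%:E)%E.
  rewrite /I lebesgue_measure_itv/=; case: ifP => _; last by rewrite lee_fin ltW.
  rewrite -EFinD lee_fin.
  have : a * (sup A - e / (a + b)) <= a * x by rewrite ler_pM2l// ltW.
  have : b * y <= b * (inf B + e / (a + b)) by rewrite ler_pM2l// ltW.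
  have : e = a * (e / (a + b)) + b * (e / (a + b)) by field; rewrite gt_eqF.
  lra.
apply: (@le_trans _ _ (mu P + (mu (Q `\` I) + mu I))%E); first exact: leeD2l.
rewrite addeA; apply: leeD => //.
rewrite -measureU//; last exact: measurableD.
apply: le_measure; rewrite ?inE//; first by apply: measurableU => //; exact: measurableD.
by move=> z [/PC|[/QC]].
Qed.

End minkowski_1d.

(** * Bounded functions supported in a set of finite measure *)

Section bounded_support.
Context {d} {T : measurableType d} {R : realType} (mu : {measure set T -> \bar R}).
Implicit Types (D : set T) (f : T -> R) (M : R).

Lemma EFin_Rintegral f : mu.-integrable setT (EFin \o f) ->
  ((\int[mu]_x f x)%:E = \int[mu]_x (f x)%:E)%E.
Proof. by move=> fi; rewrite fineK//; exact: (integrable_fin_num measurableT fi). Qed.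

Lemma integrable_indic_finite D : measurable D -> (mu D < +oo)%E ->
  mu.-integrable setT (EFin \o (\1_D : T -> R)).
Proof.
move=> mD Doo; apply/integrableP; split.
  by apply/measurable_EFinP; exact: measurable_indic.
rewrite (eq_integral (fun x => (\1_D x)%:E)); last first.
  by move=> x _; rewrite /= ger0_norm.
by rewrite integral_indic// setIT.
Qed.

Lemma integrable_bounded_support D f M : measurable D -> (mu D < +oo)%E ->
  measurable_fun setT f -> (forall x, 0 <= f x <= M) ->
  (forall x, ~ D x -> f x = 0) -> mu.-integrable setT (EFin \o f).
Proof.
move=> mD Doo mf fM fD.
apply: (@le_integrable _ _ _ mu setT measurableT _ (fun x => (M%:E * (\1_D x)%:E)%E)).
- exact/measurable_EFinP.
- move=> x _; have /andP[f0 fx] := fM x.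
  rewrite /= lee_fin indicE.
  have [Dx|Dx] := boolP (x \in D).
    by rewrite mulr1 ger0_norm// ger0_norm// (le_trans f0).
  by rewrite fD ?normr0//; move/mem_set; rewrite (negbTE Dx).
- by apply: integrableZl => //; exact: integrable_indic_finite.
Qed.

Lemma Rintegral_le_support D f M : measurable D -> (mu D < +oo)%E ->
  measurable_fun setT f -> (forall x, 0 <= f x <= M) ->
  (forall x, ~ D x -> f x = 0) -> \int[mu]_x f x <= M * fine (mu D).
Proof.
move=> mD Doo mf fM fD.
have iD := integrable_indic_finite mD Doo.
have -> : fine (mu D) = \int[mu]_x \1_D x.
  by rewrite /Rintegral (@integral_indic _ _ _ mu setT)// setIT.
rewrite -RintegralZl//; apply: le_Rintegral => //.
- exact: (integrable_bounded_support mD Doo).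
- exact: (integrableZl measurableT M iD).
- move=> x _; rewrite indicE; have [Dx|Dx] := boolP (x \in D).
    by rewrite mulr1; case/andP: (fM x).
  by rewrite fD ?mulr0//; move/mem_set; rewrite (negbTE Dx).
Qed.

Lemma Rintegral_ge_support D f M : measurable D -> (mu D < +oo)%E ->
  mu.-integrable setT (EFin \o f) -> (forall x, 0 <= f x) ->
  (forall x, D x -> M <= f x) -> M * fine (mu D) <= \int[mu]_x f x.
Proof.
move=> mD Doo fi f0 fM.
have iD := integrable_indic_finite mD Doo.
have -> : fine (mu D) = \int[mu]_x \1_D x.
  by rewrite /Rintegral (@integral_indic _ _ _ mu setT)// setIT.
rewrite -RintegralZl//; apply: le_Rintegral => //.
- exact: (integrableZl measurableT M iD).
- move=> x _; rewrite indicE; have [Dx|Dx] := boolP (x \in D).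
    by rewrite mulr1; apply: fM; exact: set_mem.
  by rewrite mulr0.
Qed.

End bounded_support.

(** * The layer cake formula and the inequality for functions of supremum one *)

Section layer_cake_1d.
Context {R : realType}.
Local Notation mu := (@lebesgue_measure R).
Local Notation RR := (measurableTypeR R).

Lemma measurable_hypograph (F : RR -> R) : measurable_fun setT F ->
  measurable [set z : RR * RR | 0 <= z.2 < F z.1].
Proof.
move=> mF.
rewrite [X in measurable X](_ : _ =
   (fun z : RR * RR => 0 <= z.2) @^-1` [set true] `&`
   (fun z : RR * RR => z.2 < F z.1) @^-1` [set true]); last first.
  by apply/seteqP; split => z /= => [/andP//|[-> ->]].
apply: measurableI.
- have : measurable_fun setT (fun z : RR * RR => 0 <= z.2).
    exact: measurable_fun_ler.
  by move=> /(_ measurableT [set true]); rewrite setTI; exact.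
- have : measurable_fun setT (fun z : RR * RR => z.2 < F z.1).
    by apply: measurable_fun_ltr => //; exact: measurableT_comp.
  by move=> /(_ measurableT [set true]); rewrite setTI; exact.
Qed.

(* Empty for [t < 0], so that the layer cake formula can range over all of [R]. *)
Definition superlevel (F : RR -> R) (t : R) : set RR := [set x | 0 <= t < F x].

Lemma measurable_superlevel (F : RR -> R) (t : R) : measurable_fun setT F ->
  measurable (superlevel F t).
Proof.
move=> mF; have := measurable_ysection t (measurable_hypograph mF).
by rewrite /ysection/=; congr (measurable _); apply/seteqP; split=> x /=; rewrite inE.
Qed.

Lemma measurable_fun_superlevel (F : RR -> R) : measurable_fun setT F ->
  measurable_fun setT (fun t : RR => mu (superlevel F t)).
Proof.
move=> mF; have := measurable_fun_ysection mu (measurable_hypograph mF).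
congr (measurable_fun setT _); apply/funext => t /=; congr (mu _).
by rewrite /ysection; apply/seteqP; split=> x /=; rewrite inE.
Qed.

(** Tonelli on the hypograph: its vertical sections have length F x, its horizontal ones are the
    superlevel sets. *)
Lemma layer_cake (F : RR -> R) : measurable_fun setT F -> (forall x, 0 <= F x) ->
  (\int[mu]_x (F x)%:E = \int[mu]_t mu (superlevel F t))%E.
Proof.
move=> mF F0; have mh := measurable_hypograph mF.
pose h (z : RR * RR) : \bar R := (\1_[set z : RR * RR | 0 <= z.2 < F z.1] z)%:E.
transitivity (\int[mu]_x \int[mu]_t h (x, t))%E.
  apply: eq_integral => x _.
  transitivity (\int[mu]_t (\1_(`[0%R, F x[%classic : set RR) t)%:E)%E.
    have <- : mu `[0%R, F x[%classic = (F x)%:E.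
      rewrite lebesgue_measure_itv/= lte_fin.
      by have := F0 x; rewrite le_eqVlt => /predU1P[<-|->]; rewrite ?ltxx// sube0.
    by rewrite integral_indic// setIT.
  apply: eq_integral => t _; rewrite /h !indicE; congr (((nat_of_bool _)%:R)%:E).
rewrite fubini_tonelli//; last 2 first.
  by apply/measurable_EFinP; exact: measurable_indic.
  by move=> z; rewrite lee_fin.
apply: eq_integral => t _.
transitivity (\int[mu]_x (\1_(superlevel F t) x)%:E)%E.
  apply: eq_integral => x _; rewrite /h !indicE; congr (((nat_of_bool _)%:R)%:E).
by rewrite integral_indic ?setIT//; exact: measurable_superlevel.
Qed.

(** Since F and G both have supremum 1, their superlevel sets are nonempty for the same levels 0 <=
    t < 1. The one-dimensional Minkowski inequality then applies level by level, and integrating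
    over t gives an arithmetic rather than a geometric mean. *)
Lemma prekopa_leindler_sup1 (a b c : R) (F G H : RR -> R) : 0 < a -> 0 < b ->
  measurable_fun setT F -> measurable_fun setT G -> measurable_fun setT H ->
  (forall x, 0 <= F x <= 1) -> (forall x, 0 <= G x <= 1) -> (forall x, 0 <= H x) ->
  (forall x, ~ (`|x| <= c) -> F x = 0) -> (forall x, ~ (`|x| <= c) -> G x = 0) ->
  (forall t, t < 1 -> exists x, t < F x) -> (forall t, t < 1 -> exists x, t < G x) ->
  (forall x y t, 0 <= t -> t < F x -> t < G y -> t < H (a * x + b * y)) ->
  (a%:E * \int[mu]_x (F x)%:E + b%:E * \int[mu]_x (G x)%:E <= \int[mu]_x (H x)%:E)%E.
Proof.
move=> a0 b0 mF mG mH F01 G01 H0 Fc Gc F1 G1 FGH.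
have F0 x : 0 <= F x by case/andP: (F01 x).
have G0 x : 0 <= G x by case/andP: (G01 x).
rewrite !layer_cake// -ge0_integralZl//; last 2 first.
- exact: measurable_fun_superlevel.
- by rewrite lee_fin ltW.
rewrite -ge0_integralZl//; last 2 first.
- exact: measurable_fun_superlevel.
- by rewrite lee_fin ltW.
rewrite -ge0_integralD//; last 4 first.
- by move=> t _; apply: mule_ge0 => //; rewrite lee_fin ltW.
- by apply: measurable_funeM; exact: measurable_fun_superlevel.
- by move=> t _; apply: mule_ge0 => //; rewrite lee_fin ltW.
- by apply: measurable_funeM; exact: measurable_fun_superlevel.
apply: ge0_le_integral => //.
- by move=> t _; apply: adde_ge0; apply: mule_ge0 => //; rewrite lee_fin ltW.
- apply: emeasurable_funD; apply: measurable_funeM; exact: measurable_fun_superlevel.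
- exact: measurable_fun_superlevel.
move=> t _; have [t0|t0] := ltP t 0.
  have E (K : RR -> R) : superlevel K t = set0.
    by apply/seteqP; split=> // x; rewrite /superlevel/= leNgt t0.
  by rewrite /= !E measure0 !mule0 adde0.
have [t1|t1] := ltP t 1; last first.
  have E (K : RR -> R) : (forall x, 0 <= K x <= 1) -> superlevel K t = set0.
    move=> K1; apply/seteqP; split=> // x; rewrite /superlevel/= => /andP[_ tK].
    by have /andP[_ /(lt_le_trans tK)] := K1 x; rewrite ltNge t1.
  by rewrite /= (E F)// (E G)// measure0 !mule0 adde0.
apply: (@lebesgue_measure_minkowski _ a b c) => //.
- exact: measurable_superlevel.
- exact: measurable_superlevel.
- exact: measurable_superlevel.
- by have [x Fx] := F1 _ t1; exists x; rewrite /superlevel/= t0.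
- by have [x Gx] := G1 _ t1; exists x; rewrite /superlevel/= t0.
- move=> x; rewrite /superlevel/= => /andP[_ tF]; apply: contrapT => /Fc F0'.
  by move: tF; rewrite F0' ltNge t0.
- move=> x; rewrite /superlevel/= => /andP[_ tG]; apply: contrapT => /Gc G0'.
  by move: tG; rewrite G0' ltNge t0.
- move=> x y; rewrite /superlevel/= => /andP[_ tF] /andP[_ tG]; rewrite t0/=; exact: FGH.
Qed.

End layer_cake_1d.

Section prekopa_leindler_1d.
Context {R : realType}.
Local Notation mu := (@lebesgue_measure R).
Local Notation RR := (measurableTypeR R).

Lemma powR_amgm (u v p q : R) : 0 <= u -> 0 <= v -> 0 < p -> 0 < q -> p + q = 1 ->
  u `^ p * v `^ q <= p * u + q * v.
Proof.
move=> u0 v0 p0 q0 pq.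
have := @conjugate_powR R (u `^ p) (v `^ q) p^-1 q^-1 (powR_ge0 _ _) (powR_ge0 _ _).
rewrite !invr_gt0 !invrK -!powRrM !divff ?gt_eqF// !powRr1// => /(_ p0 q0 pq).
by rewrite (mulrC u) (mulrC v).
Qed.

Lemma integrable_bounded_interval (F : RR -> R) c : measurable_fun setT F ->
  (forall x, 0 <= F x <= c) -> (forall x, ~ (`|x| <= c) -> F x = 0) ->
  mu.-integrable setT (EFin \o F).
Proof.
move=> mF F0 Fc.
have Ioo : (mu `[(- c)%R, c]%classic < +oo)%E.
  by rewrite lebesgue_measure_itv/=; case: ifP => _; rewrite ?ltry// -EFinN -EFinD ltry.
apply: (@integrable_bounded_support _ _ _ mu `[-c, c]%classic F c) => //.
by move=> x /=; rewrite in_itv/= -ler_norml; exact: Fc.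
Qed.

(** The constant [m] is the supremum of F, the divisor that normalises F to supremum 1. *)
Lemma sup_range_adherent (F : RR -> R) (c x0 : R) : (forall x, F x <= c) -> 0 < F x0 ->
  exists2 m, 0 < m & (forall x, F x <= m) /\ (forall t, t < 1 -> exists x, t < F x / m).
Proof.
move=> Fc Fx0.
have hs : has_sup (range F) by split; [exists (F x0), x0|exists c => _ [x _ <-]].
have ub x : F x <= sup (range F) by apply: ub_le_sup; [exact: hs.2|exists x].
have m0 : 0 < sup (range F) by exact: lt_le_trans (ub x0).
exists (sup (range F)) => //; split=> // t t1.
have [|_ [x _ <-] xt] := @sup_adherent _ _ ((1 - t) * sup (range F)) _ hs.
  by rewrite mulr_gt0// subr_gt0.
exists x; rewrite ltr_pdivlMr//; apply: le_lt_trans xt.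
by rewrite mulrBl mul1r opprB addrCA subrr addr0.
Qed.

(** Dividing F and G by their suprema [al], [be] and H by al^p be^q reduces to the normalised
    inequality; the arithmetic-geometric mean inequality then gives the geometric form. The constant
    [c] is at once a bound and a radius of the support. *)
Lemma prekopa_leindler1 (a b p q s0 s1 s c : R) (F G H : RR -> R) :
  0 < a -> 0 < b -> 0 < p -> 0 < q -> 0 < s0 -> 0 < s1 -> 0 < s ->
  p + q = 1 -> p * s = a * s0 -> q * s = b * s1 ->
  measurable_fun setT F -> measurable_fun setT G -> measurable_fun setT H ->
  (forall x, 0 <= F x <= c) -> (forall x, 0 <= G x <= c) -> (forall x, 0 <= H x <= c) ->
  (forall x, ~ (`|x| <= c) -> F x = 0) -> (forall x, ~ (`|x| <= c) -> G x = 0) ->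
  (forall x, ~ (`|x| <= c) -> H x = 0) ->
  (forall x y, F x `^ p * G y `^ q <= H (a * x + b * y)) ->
  (\int[mu]_x F x / s0) `^ p * (\int[mu]_x G x / s1) `^ q <= \int[mu]_x H x / s.
Proof.
move=> a0 b0 p0 q0 s00 s10 s_gt0 pq ps qs mF mG mH Fc Gc Hc Fs Gs Hs FGH.
have F0 x : 0 <= F x by case/andP: (Fc x).
have G0 x : 0 <= G x by case/andP: (Gc x).
have H0 x : 0 <= H x by case/andP: (Hc x).
have iF := integrable_bounded_interval mF Fc Fs.
have iG := integrable_bounded_interval mG Gc Gs.
have iH := integrable_bounded_interval mH Hc Hs.
have I0 (K : RR -> R) : (forall x, 0 <= K x) -> 0 <= \int[mu]_x K x.
  by move=> K0; apply: Rintegral_ge0 => x _; exact: K0.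
have IH0 : 0 <= \int[mu]_x H x / s by rewrite divr_ge0 ?I0// ltW.
have I00 (K : RR -> R) : (forall x, 0 <= K x) -> ~ (exists x, 0 < K x) -> \int[mu]_x K x = 0.
  move=> K0 nK; have -> : K = cst 0; last by rewrite /Rintegral integral0.
  by apply/funext => x; apply/eqP; rewrite eq_le K0 andbT leNgt; apply/negP => Kx;
    apply: nK; exists x.
(* If F or G vanishes identically, 0 to a positive power makes the left-hand side 0; otherwise both
   suprema are positive. *)
have [[x0 Fx0]|/(I00 _ F0) ->] := pselect (exists x, 0 < F x); last first.
  by rewrite mul0r powR0 ?gt_eqF// mul0r.
have [[y0 Gy0]|/(I00 _ G0) ->] := pselect (exists x, 0 < G x); last first.
  by rewrite mul0r [X in _ * X]powR0 ?gt_eqF// mulr0.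
have [al al0 [Fal alF]] := sup_range_adherent (fun x => (andP (Fc x)).2) Fx0.
have [be be0 [Gbe beG]] := sup_range_adherent (fun x => (andP (Gc x)).2) Gy0.
pose ga := al `^ p * be `^ q.
have ga0 : 0 < ga by rewrite mulr_gt0 ?powR_gt0.
have key : a * (\int[mu]_x F x / al) + b * (\int[mu]_x G x / be) <= \int[mu]_x H x / ga.
  have S (K : RR -> R) (m : R) : measurable_fun setT K -> mu.-integrable setT (EFin \o K) ->
     (\int[mu]_x (K x / m)%:E = (\int[mu]_x K x / m)%:E)%E.
    move=> mK iK; rewrite -(RintegralZr _ measurableT iK) EFin_Rintegral//.
    exact: (integrableZr measurableT m^-1 iK).
  rewrite -lee_fin EFinD (EFinM a) (EFinM b) -!S//.
  apply: (@prekopa_leindler_sup1 _ a b c) => //.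
  - by apply: measurable_funM => //; exact: measurable_cst.
  - by apply: measurable_funM => //; exact: measurable_cst.
  - by apply: measurable_funM => //; exact: measurable_cst.
  - by move=> x; rewrite divr_ge0 ?(ltW al0)//= ler_pdivrMr// mul1r.
  - by move=> x; rewrite divr_ge0 ?(ltW be0)//= ler_pdivrMr// mul1r.
  - by move=> x; rewrite divr_ge0 ?(ltW ga0).
  - by move=> x /Fs ->; rewrite mul0r.
  - by move=> x /Gs ->; rewrite mul0r.
  move=> x y t t0; rewrite !ltr_pdivlMr// => tF tG.
  apply: lt_le_trans (FGH x y).
  have -> : t * ga = (t * al) `^ p * (t * be) `^ q.
    rewrite !powRM ?(ltW al0) ?(ltW be0)// mulrACA -/ga.
    have [->|tn0] := eqVneq t 0; first by rewrite powR0 ?gt_eqF// !mul0r.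
    by rewrite -powRD ?pq ?powRr1// tn0 implybT.
  apply: ltr_pM; rewrite ?powR_ge0//; apply: gt0_ltr_powR => //;
    by rewrite nnegrE ?mulr_ge0// ltW.
pose u := \int[mu]_x F x / (al * s0).
pose v := \int[mu]_x G x / (be * s1).
have u0 : 0 <= u by rewrite divr_ge0 ?I0// ltW// mulr_gt0.
have v0 : 0 <= v by rewrite divr_ge0 ?I0// ltW// mulr_gt0.
have -> : \int[mu]_x F x / s0 = al * u by rewrite /u; field; rewrite !gt_eqF.
have -> : \int[mu]_x G x / s1 = be * v by rewrite /v; field; rewrite !gt_eqF.
rewrite (@powRM _ al u p) ?(ltW al0)// (@powRM _ be v q) ?(ltW be0)// mulrACA -/ga.
rewrite ler_pdivlMr// [ga * _]mulrC mulrAC -ler_pdivlMr//; apply: le_trans key.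
apply: (@le_trans _ _ ((p * u + q * v) * s)).
  by rewrite ler_pM2r//; exact: powR_amgm.
(* The relations p s = a s0 and q s = b s1 turn the weights [p], [q] into the coefficients [a], [b]
   of [key]. *)
rewrite mulrDl (mulrAC p) (mulrAC q) ps qs /u /v.
by rewrite le_eqVlt; apply/orP; left; apply/eqP; field; rewrite !gt_eqF.
Qed.

End prekopa_leindler_1d.

(** * The Prekopa-Leindler inequality in R^n *)

Section boxes.
Context {R : realType}.
Local Notation mu := (@lebesgue_measure R).
Local Notation RR := (measurableTypeR R).
Local Notation leb := (@borel_lebesgue R).

Lemma cons_tupleP n (P : 'I_n.+1 -> Prop) :
  (forall i, P i) <-> P ord0 /\ forall j, P (lift ord0 j).
Proof.
split=> [h|[P0 PS] i]; first by split=> [|j]; exact: h.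
by case: (unliftP ord0 i) => [j|] ->.
Qed.

(** The bounds are indexed by [nat], so that the bounds of a tail are a mere shift. *)
Definition box n (l u : nat -> R) : set (n.-tuple R) :=
  [set y | forall i : 'I_n, l i <= tnth y i <= u i].

Lemma box_cons n (l u : nat -> R) x (y : n.-tuple R) :
  box l u [tuple of x :: y] <->
  l 0%N <= x <= u 0%N /\ box (fun i => l i.+1) (fun i => u i.+1) y.
Proof.
rewrite /box/= cons_tupleP tnth0; split=> -[h0 h]; split=> // j.
  by have := h j; rewrite tnthS lift0.
by rewrite tnthS lift0; exact: h.
Qed.

Lemma measurable_box n l u : measurable (@box n l u).
Proof.
rewrite (_ : box l u = \bigcap_(i in [set: 'I_n])
  ((fun y => tnth y i) @^-1` `[l i, u i]%classic)); last first.
  apply/seteqP; split=> [y yB i _|y yB i]; first by rewrite /= in_itv/=; exact: yB.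
  by have := yB i I; rewrite /= in_itv.
apply: fin_bigcap_measurable => // i _.
by rewrite -[X in measurable X]setTI; apply: measurable_tnth => //; exact: measurable_itv.
Qed.

Lemma borel_lebesgue_box n (l u : nat -> R) : (forall i, l i <= u i) ->
  leb n (box l u) = (\prod_(i < n) (u i - l i))%:E.
Proof.
elim: n l u => [|n IHn] l u lu.
  rewrite big_ord0 /= /dirac/= indicE mem_set// => -[].
  by [].
rewrite /= /lebesgue_step /pushforward.
rewrite [X in (_ \x _)%E X](_ : _ =
  `[l 0%N, u 0%N]%classic `*` box (fun i => l i.+1) (fun i => u i.+1)); last first.
  apply/seteqP; split=> [[x y] /box_cons|[x y]]/=; first by rewrite in_itv.
  by rewrite in_itv/= => h; apply/box_cons.
rewrite product_measure1E//; last exact: measurable_box.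
rewrite IHn// big_ord_recl/= EFinM; congr (_ * _)%E.
have -> : mu `[l 0%N, u 0%N]%classic = (u 0%N - l 0%N)%:E; last by [].
rewrite lebesgue_measure_itv/= lte_fin; have := lu 0%N; rewrite le_eqVlt.
by move=> /predU1P[->|->]; rewrite ?ltxx ?subrr.
Qed.

Lemma ge0_integral_borel_lebesgueS n (f : n.+1.-tuple R -> \bar R) :
  measurable_fun setT f -> (forall y, 0 <= f y)%E ->
  (\int[leb n.+1]_y f y = \int[mu]_x \int[leb n]_y f [tuple of x :: y])%E.
Proof.
move=> mf f0.
have mc := @measurable_tuple_of_pair R n.
transitivity (\int[pushforward (mu \x leb n)%E (@tuple_of_pair R n)]_y f y)%E.
  exact: eq_measure_integral.
rewrite ge0_integral_pushforward//= preimage_setT fubini_tonelli1//.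
by apply: measurableT_comp.
Qed.

End boxes.

Section prekopa_leindler_nd.
Context {R : realType}.
Local Notation mu := (@lebesgue_measure R).
Local Notation RR := (measurableTypeR R).
Local Notation leb := (@borel_lebesgue R).

Definition cube (c : R) n : set (n.-tuple R) := box (fun=> - c) (fun=> c).

(** One constant bounds both the values and the support, and it is inherited by slices; this makes
    integrability automatic throughout the induction on [n]. *)
Definition tame n (c : R) (f : n.-tuple R -> R) :=
  [/\ measurable_fun setT f, forall y, 0 <= f y <= c &
      forall y, ~ cube c y -> f y = 0].

Lemma tame_ge0 n c (f : n.-tuple R -> R) y : tame c f -> 0 <= f y.
Proof. by case=> _ /(_ y) /andP[]. Qed.

Lemma tame_cst_ge0 n c (f : n.-tuple R -> R) : tame c f -> 0 <= c.
Proof. by case=> _ /(_ [tuple of nseq n 0]) /andP[f0 /(le_trans f0)]. Qed.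

Lemma tame_integrable n c (f : n.-tuple R -> R) : tame c f ->
  (leb n).-integrable setT (EFin \o f).
Proof.
move=> tf; have c0 := tame_cst_ge0 tf; case: tf => mf fc fs.
apply: (@integrable_bounded_support _ _ _ (leb n) (@cube c n) f c) => //.
  exact: measurable_box.
rewrite [X in (X < _)%E](_ : _ = leb n (cube c (n:=n)))//.
by rewrite borel_lebesgue_box ?ltry// => _; rewrite lerNl (le_trans _ c0)// oppr_le0.
Qed.

Lemma Rintegral_box_le n c (f : n.-tuple R -> R) (M : R) (l u : nat -> R) : tame c f ->
  (forall i, l i <= u i) -> (forall y, f y <= M) ->
  (forall y, ~ box l u y -> f y = 0) ->
  \int[leb n]_y f y <= M * \prod_(i < n) (u i - l i).
Proof.
move=> tf lu fM fs; have bE := @borel_lebesgue_box R n l u lu.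
have -> : \prod_(i < n) (u i - l i) = fine (leb n (box l u)) by rewrite bE.
apply: Rintegral_le_support => //; [exact: measurable_box| |by case: tf|].
  rewrite [X in (X < _)%E](_ : _ = leb n (box l u))//.
  by rewrite bE ltry.
by move=> y; rewrite fM (tame_ge0 _ tf).
Qed.

Lemma Rintegral_box_ge n c (f : n.-tuple R -> R) (M : R) (l u : nat -> R) : tame c f ->
  (forall i, l i <= u i) -> (forall y, box l u y -> M <= f y) ->
  M * \prod_(i < n) (u i - l i) <= \int[leb n]_y f y.
Proof.
move=> tf lu fM; have bE := @borel_lebesgue_box R n l u lu.
have -> : \prod_(i < n) (u i - l i) = fine (leb n (box l u)) by rewrite bE.
apply: Rintegral_ge_support => //; [exact: measurable_box| |exact: tame_integrable tf|].
  rewrite [X in (X < _)%E](_ : _ = leb n (box l u))//.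
  by rewrite bE ltry.
by move=> y; rewrite (tame_ge0 _ tf).
Qed.

Definition slice n (f : n.+1.-tuple R -> R) (x : R) (y : n.-tuple R) : R :=
  f [tuple of x :: y].

Lemma measurable_cons_pair n :
  measurable_fun setT (fun p : RR * n.-tuple R => [tuple of p.1 :: p.2]).
Proof. exact: measurable_tuple_of_pair. Qed.

Lemma tame_slice n c (f : n.+1.-tuple R -> R) x : tame c f -> tame c (slice f x).
Proof.
move=> [mf fc fs]; split=> [|y|y ny]; last 2 first.
- exact: fc.
- by apply: fs => /box_cons[].
apply: (measurableT_comp mf).
exact: (measurable_cons (measurable_cst x) (@measurable_id _ _ _)).
Qed.

Lemma slice_eq0 n c (f : n.+1.-tuple R -> R) x y : tame c f -> ~ (`|x| <= c) ->
  slice f x y = 0.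
Proof.
by move=> [_ _ fs] xc; apply: fs => /box_cons[]; rewrite -ler_norml => /xc.
Qed.

Definition marginal n (f : n.+1.-tuple R -> R) (x : R) : R :=
  \int[leb n]_y slice f x y.

Lemma measurable_marginal n c (f : n.+1.-tuple R -> R) : tame c f ->
  measurable_fun setT (marginal f : RR -> R).
Proof.
move=> tf; have [mf _ _] := tf.
apply: (measurableT_comp (fine_measurable measurableT)).
apply: (measurable_fun_fubini_tonelli_F
  (fun p : RR * n.-tuple R => (f [tuple of p.1 :: p.2])%:E)).
- by apply/measurable_EFinP; apply: (measurableT_comp mf); exact: measurable_cons_pair.
- by move=> p; rewrite lee_fin (tame_ge0 _ tf).
Qed.

Lemma marginal_bounded n c (f : n.+1.-tuple R -> R) x : tame c f ->
  0 <= marginal f x <= c * (c + c) ^+ n.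
Proof.
move=> tf; have c0 := tame_cst_ge0 tf; have ts := tame_slice x tf.
rewrite Rintegral_ge0/=; last by move=> y _; exact: tame_ge0 ts.
have -> : (c + c) ^+ n = \prod_(i < n) (c - - c).
  by rewrite prodr_const card_ord opprK.
apply: (Rintegral_box_le (l := fun=> - c) (u := fun=> c) ts).
- by move=> _; rewrite lerNl (le_trans _ c0)// oppr_le0.
- by move=> y; case: ts => _ /(_ y) /andP[].
- by case: ts.
Qed.

Lemma marginal_eq0 n c (f : n.+1.-tuple R -> R) x : tame c f -> ~ (`|x| <= c) ->
  marginal f x = 0.
Proof.
move=> tf xc; rewrite /marginal.
have -> : slice f x = cst 0 by apply/funext => y; exact: slice_eq0 tf xc.
by rewrite /Rintegral integral0.
Qed.

Lemma Rintegral_borel_lebesgueS n c (f : n.+1.-tuple R -> R) : tame c f ->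
  \int[leb n.+1]_y f y = \int[mu]_x marginal f x.
Proof.
move=> tf; have [mf _ _] := tf; rewrite /Rintegral ge0_integral_borel_lebesgueS.
- congr fine; apply: eq_integral => x _; rewrite EFin_Rintegral//.
  exact: tame_integrable (tame_slice x tf).
- exact/measurable_EFinP.
- by move=> y; rewrite lee_fin (tame_ge0 _ tf).
Qed.

Definition comb n (a b : R) (y z : n.-tuple R) : n.-tuple R :=
  [tuple a * tnth y i + b * tnth z i | i < n].

Lemma comb_cons n a b x x' (y y' : n.-tuple R) :
  comb a b [tuple of x :: y] [tuple of x' :: y'] =
  [tuple of a * x + b * x' :: comb a b y y'].
Proof.
apply: eq_from_tnth => i; rewrite tnth_mktuple.
by case: (unliftP ord0 i) => [j|] ->; rewrite ?tnthS ?tnth0// tnth_mktuple.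
Qed.

(* Prekopa-Leindler with weights [p], [q] for the functions [z |-> f (s0 z)],
   [z |-> g (s1 z)], [z |-> h (s z)]: stated so that no change of variables is
   needed. *)
Lemma prekopa_leindler n (a b p q s0 s1 s c : R) (f g h : n.-tuple R -> R) :
  0 < a -> 0 < b -> 0 < p -> 0 < q -> 0 < s0 -> 0 < s1 -> 0 < s ->
  p + q = 1 -> p * s = a * s0 -> q * s = b * s1 ->
  tame c f -> tame c g -> tame c h ->
  (forall y z, f y `^ p * g z `^ q <= h (comb a b y z)) ->
  (\int[leb n]_y f y / s0 ^+ n) `^ p * (\int[leb n]_y g y / s1 ^+ n) `^ q <=
  \int[leb n]_y h y / s ^+ n.
Proof.
move=> a0 b0 p0 q0 s00 s10 sgt0 pq ps qs.
elim: n => [|n IHn] in f g h *.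
  move=> tf tg th fgh.
  (* In dimension 0 the measure is the Dirac mass at the empty tuple. *)
  have I0 (k : 0.-tuple R -> R) : tame c k -> \int[leb 0]_y k y = k [tuple].
    move=> [mk _ _]; rewrite /Rintegral integral_dirac//; last exact/measurable_EFinP.
    by rewrite diracT mul1e.
  rewrite !I0// !expr0 !divr1; apply: le_trans (fgh _ _) _.
  by rewrite [comb _ _ _ _]tuple0.
move=> tf tg th fgh; have c0 := tame_cst_ge0 tf.
rewrite !(Rintegral_borel_lebesgueS (c := c))//.
(* The scaled marginals are at most c (2c)^n r^-n with r among s0, s1, s, and supported in radius
   [c]; [C] dominates all these at once. *)
pose C := c + c * (c + c) ^+ n * (s0 ^- n + s1 ^- n + s ^- n).
have cn0 : 0 <= c * (c + c) ^+ n by rewrite mulr_ge0// exprn_ge0// addr_ge0.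
have V (r : R) : 0 < r -> 0 <= r ^- n by move=> r0; rewrite invr_ge0 exprn_ge0// ltW.
have CB (k : n.+1.-tuple R -> R) (r : R) : tame c k -> 0 < r -> r ^- n <= s0 ^- n + s1 ^- n + s ^- n ->
   forall x, 0 <= marginal k x / r ^+ n <= C.
  move=> tk r0 rs x; have /andP[m0 mC] := marginal_bounded x tk.
  rewrite mulr_ge0 ?V//=; apply: (@le_trans _ _ (c * (c + c) ^+ n * r ^- n)).
    by rewrite ler_wpM2r ?V.
  by rewrite /C; apply: (le_trans (ler_wpM2l cn0 rs)); rewrite lerDr.
have cC : c <= C by rewrite /C lerDl mulr_ge0// !addr_ge0 ?V.
have CS (k : n.+1.-tuple R -> R) (r : R) : tame c k ->
   forall x, ~ (`|x| <= C) -> marginal k x / r ^+ n = 0.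
  move=> tk x xC; rewrite (marginal_eq0 tk) ?mul0r// => xc.
  by apply: xC; exact: le_trans xc cC.
have M (k : n.+1.-tuple R -> R) (r : R) : tame c k ->
    measurable_fun setT (fun x : RR => marginal k x / r ^+ n).
  by move=> tk; apply: measurable_funM; [exact: measurable_marginal tk|exact: measurable_cst].
have IZ (k : n.+1.-tuple R -> R) (r : R) : tame c k -> 0 < r ->
    \int[mu]_x marginal k x / r ^+ n.+1 = \int[mu]_x (marginal k x / r ^+ n) / r.
  move=> tk r0; rewrite RintegralZr//; last first.
    apply: (@integrable_bounded_interval _ _ (C + c * (c + c) ^+ n)).
    - exact: measurable_marginal tk.
    - move=> x; have /andP[-> mC] := marginal_bounded x tk.
      by rewrite (le_trans mC)// lerDr (le_trans c0).
    - move=> x xC; apply: (marginal_eq0 tk) => xc; apply: xC.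
      by rewrite (le_trans xc)// (le_trans cC)// lerDl.
  by rewrite exprS invfM mulrA (mulrAC _ r^-1).
rewrite !IZ//.
apply: (@prekopa_leindler1 _ a b p q s0 s1 s C) => //; try exact: M; try exact: CS.
- by apply: CB => //; rewrite -addrA lerDl addr_ge0 ?V.
- by apply: CB => //; rewrite addrAC lerDr addr_ge0 ?V.
- by apply: CB => //; rewrite lerDr addr_ge0 ?V.
(* The induction hypothesis for slices is the pointwise hypothesis of the one-dimensional inequality
   for the scaled marginals. *)
move=> x x'; apply: IHn; [exact: tame_slice..|].
by move=> y z; apply: le_trans (fgh _ _) _; rewrite comb_cons.
Qed.

End prekopa_leindler_nd.

(** * Gaussian masses of bodies and their cuts *)

Section kernel.
Context {R : realType} {n : nat}.
Local Notation leb := (@borel_lebesgue R n).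
Implicit Types (x : 'I_n -> R) (s : R) (y z : n.-tuple R) (S : set (n.-tuple R)).

(** The heat kernel at time s^2, without its normalising factor. *)
Definition kernel x s y : R := expR (- (\sum_i ((tnth y i - x i) / s) ^+ 2 / 4)).

Definition kernel_mass x s S : R := \int[leb]_y (kernel x s y * \1_S y).

Lemma kernel_le1 x s y : kernel x s y <= 1.
Proof.
rewrite /kernel -[leRHS]expR0 ler_expR oppr_le0.
by apply: sumr_ge0 => i _; rewrite mulr_ge0// sqr_ge0.
Qed.

Lemma measurable_kernel x s : measurable_fun setT (kernel x s).
Proof.
apply: (measurableT_comp (@measurable_expR R)).
apply: measurable_funN; apply: measurable_sum => i.
apply: measurable_funM; last exact: measurable_cst.
apply: measurable_funX; apply: measurable_funM; last exact: measurable_cst.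
by apply: measurable_funB; [exact: measurable_tnth|exact: measurable_cst].
Qed.

(** This is the exponential of p |u|^2 + q |v|^2 - p q |u - v|^2 = |p u + q v|^2, valid for p + q =
    1, with u and v the rescaled points. It is the quantitative form of strict convexity. *)
Lemma kernel_comb x0 x1 s0 s1 s a b p q y z : s0 != 0 -> s1 != 0 -> s != 0 ->
  p + q = 1 -> p * s = a * s0 -> q * s = b * s1 ->
  kernel x0 s0 y `^ p * kernel x1 s1 z `^ q *
    expR (p * q / 4 * \sum_i ((tnth y i - x0 i) / s0 - (tnth z i - x1 i) / s1) ^+ 2) =
  kernel (fun i => a * x0 i + b * x1 i) s (comb a b y z).
Proof.
move=> s00 s10 sn0 pq ps qs.
rewrite /kernel -!expRM -!expRD; congr expR.
rewrite !mulNr -opprD [in X in _ + X]mulr_sumr !mulr_suml -big_split/=.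
rewrite addrC -sumrB -[RHS]sumrN; apply: eq_bigr => i _.
rewrite tnth_mktuple.
have aE : a = p * s / s0 by rewrite ps mulfK.
have bE : b = q * s / s1 by rewrite qs mulfK.
have -> : (a * tnth y i + b * tnth z i - (a * x0 i + b * x1 i)) / s =
    p * ((tnth y i - x0 i) / s0) + q * ((tnth z i - x1 i) / s1).
  by rewrite aE bE; field; rewrite s00 s10.
have -> : q = 1 - p by rewrite -pq addrC addKr.
by ring.
Qed.

Variable c : R.
Hypothesis c1 : 1 <= c.

(** The kernel is bounded by 1, so 1 <= c lets the radius of the cube serve as a bound too. *)
Lemma tame_kernel x s S : measurable S -> S `<=` cube c (n:=n) ->
  tame c (fun y => kernel x s y * \1_S y).
Proof.
move=> mS Sc; split=> [|y|y yc].
- by apply: measurable_funM; [exact: measurable_kernel|exact: measurable_indic].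
- rewrite mulr_ge0 ?expR_ge0//= (le_trans _ c1)//.
  by rewrite -[leRHS]mulr1 ler_pM ?expR_ge0 ?kernel_le1// indicE; case: (_ \in _).
- by rewrite indicE memNset ?mulr0// => /Sc.
Qed.

Lemma kernel_mass_ge0 x s S : 0 <= kernel_mass x s S.
Proof. by apply: Rintegral_ge0 => y _; rewrite mulr_ge0 ?expR_ge0. Qed.

Lemma le_kernel_mass x s S T : measurable S -> measurable T -> T `<=` cube c (n:=n) ->
  S `<=` T -> kernel_mass x s S <= kernel_mass x s T.
Proof.
move=> mS mT Tc ST; have Sc := subset_trans ST Tc.
apply: le_Rintegral => //.
- exact: tame_integrable (tame_kernel x s mS Sc).
- exact: tame_integrable (tame_kernel x s mT Tc).
- move=> y _; rewrite ler_wpM2l ?expR_ge0// !indicE ler_nat.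
  by case: (boolP (y \in S)) => // /set_mem/ST/mem_set ->.
Qed.

Lemma kernel_massU x s S T : measurable S -> measurable T ->
  S `<=` cube c (n:=n) -> T `<=` cube c (n:=n) -> [disjoint S & T] ->
  kernel_mass x s (S `|` T) = kernel_mass x s S + kernel_mass x s T.
Proof.
move=> mS mT Sc Tc ST; rewrite -RintegralD//.
- apply: eq_Rintegral => y _; rewrite -mulrDr; congr (_ * _).
  rewrite !indicE in_setU; have [yS|] := boolP (y \in S); last by rewrite add0r.
  rewrite memNset ?addr0//.
  by move/set_mem : yS => yS yT; move/disj_setPS : ST => /(_ y); exact.
- exact: tame_integrable (tame_kernel x s mS Sc).
- exact: tame_integrable (tame_kernel x s mT Tc).
Qed.

Lemma kernel_mass_box x s S l u : measurable S -> S `<=` cube c (n:=n) ->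
  (forall i, l i <= u i) -> S `<=` box l u ->
  kernel_mass x s S <= \prod_(i < n) (u i - l i).
Proof.
move=> mS Sc lu Slu; rewrite -[leRHS]mul1r.
apply: (Rintegral_box_le (tame_kernel x s mS Sc)) => // y.
  by rewrite -[leRHS]mulr1 ler_pM ?expR_ge0 ?kernel_le1// indicE; case: (_ \in _).
by move=> yb; rewrite indicE memNset ?mulr0// => /Slu.
Qed.

Lemma kernel_mass_gt0 x s S y (d : R) : 0 < d -> measurable S -> S `<=` cube c (n:=n) ->
  (forall z, (forall i, `|tnth z i - tnth y i| <= d) -> S z) -> 0 < kernel_mass x s S.
Proof.
move=> d0 mS Sc yS.
(* Indices beyond [n] get the degenerate interval [0, 0], which keeps l <= u everywhere. *)
pose l i := if insub i is Some j then tnth y j - d else 0.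
pose u i := if insub i is Some j then tnth y j + d else 0.
have lE (i : 'I_n) : l i = tnth y i - d by rewrite /l valK.
have uE (i : 'I_n) : u i = tnth y i + d by rewrite /u valK.
(* A lower bound of the kernel on the whole cube, where |z_i - x_i| <= c + |x_i|. *)
pose M := expR (- (\sum_i ((c + `|x i|) / s) ^+ 2 / 4)).
have boxS z : box l u z -> S z.
  move=> zb; apply: yS => i; have := zb i; rewrite lE uE ler_norml => /andP[? ?].
  by apply/andP; split; lra.
apply: (@lt_le_trans _ _ (M * \prod_(i < n) (u i - l i))).
  rewrite mulr_gt0 ?expR_gt0//; apply: prodr_gt0 => i _.
  by rewrite lE uE; lra.
apply: (Rintegral_box_ge (tame_kernel x s mS Sc)) => [i|z /boxS Sz].
  by rewrite /l /u; case: insub => // j; lra.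
rewrite indicE mem_set// mulr1 /M /kernel ler_expR lerN2; apply: ler_sum => i _.
rewrite ler_pM2r// -real_normK ?num_real// -[leRHS]real_normK ?num_real//.
rewrite lerXn2r ?nnegrE// !normrM ler_wpM2r//.
have := Sc _ Sz i; rewrite -ler_norml => zc.
rewrite (le_trans (ler_normB _ _))// ger0_norm ?addr_ge0 ?(le_trans _ c1)//.
by rewrite lerD2r.
Qed.

(** By [kernel_comb], rescaled points at squared distance at least [k] gain the factor exp(p q k /
    4) pointwise. With k = 0 this is the plain inequality. *)
Lemma prekopa_leindler_kernel x0 x1 s0 s1 s a b p q k S0 S1 S :
  0 < a -> 0 < b -> 0 < p -> 0 < q -> 0 < s0 -> 0 < s1 -> 0 < s ->
  p + q = 1 -> p * s = a * s0 -> q * s = b * s1 -> 0 <= k ->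
  measurable S0 -> measurable S1 -> measurable S ->
  S0 `<=` cube c (n:=n) -> S1 `<=` cube c (n:=n) -> S `<=` cube c (n:=n) ->
  (forall y z, S0 y -> S1 z -> S (comb a b y z)) ->
  (forall y z, S0 y -> S1 z ->
    k <= \sum_i ((tnth y i - x0 i) / s0 - (tnth z i - x1 i) / s1) ^+ 2) ->
  expR (p * q / 4 * k) * ((kernel_mass x0 s0 S0 / s0 ^+ n) `^ p *
    (kernel_mass x1 s1 S1 / s1 ^+ n) `^ q) <=
  kernel_mass (fun i => a * x0 i + b * x1 i) s S / s ^+ n.
Proof.
move=> a0 b0 p0 q0 s00 s10 sgt0 pq ps qs k0 mS0 mS1 mS S0c S1c Sc S01 S01k.
pose e := expR (p * q / 4 * k); have e0 : 0 < e by exact: expR_gt0.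
have e1 : e^-1 <= 1.
  by rewrite invf_le1// -expR0 ler_expR !mulr_ge0// ltW.
have tS := tame_kernel (fun i => a * x0 i + b * x1 i) s mS Sc.
(* The gain is put as a divisor on the target function: since e >= 1, it stays tame with the same
   constant. *)
pose h y := (kernel (fun i => a * x0 i + b * x1 i) s y * \1_S y) / e.
have th : tame c h.
  have [mh hc hs] := tS; split=> [|y|y /hs]; last by rewrite /h => ->; rewrite mul0r.
    by apply: measurable_funM => //; exact: measurable_cst.
  have /andP[h0 h1] := hc y.
  rewrite /h divr_ge0 ?(ltW e0)//= (le_trans _ h1)//.
  by rewrite ler_piMr.
have PL := @prekopa_leindler R n a b p q s0 s1 s c _ _ h a0 b0 p0 q0 s00 s10 sgt0 pq ps qs
  (tame_kernel x0 s0 mS0 S0c) (tame_kernel x1 s1 mS1 S1c) th.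
have Jh : \int[leb]_y h y = kernel_mass (fun i => a * x0 i + b * x1 i) s S / e.
  by rewrite -RintegralZr//; exact: tame_integrable tS.
rewrite -/e mulrC -ler_pdivlMr// mulrAC -Jh; apply: PL => y z.
rewrite !indicE; have [yS|yS] := boolP (y \in S0); last first.
  by rewrite mulr0 powR0 ?gt_eqF// mul0r; case: th => _ /(_ (comb a b y z)) /andP[].
have [zS|zS] := boolP (z \in S1); last first.
  by rewrite mulr0 [X in _ * X]powR0 ?gt_eqF// mulr0;
    case: th => _ /(_ (comb a b y z)) /andP[].
move/set_mem : yS => yS; move/set_mem : zS => zS.
rewrite /h indicE mem_set ?mulr1; last exact: S01.
rewrite ler_pdivlMr// -(kernel_comb x0 x1 y z (lt0r_neq0 s00) (lt0r_neq0 s10) (lt0r_neq0 sgt0) pq ps qs).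
rewrite ler_wpM2l ?mulr_ge0 ?powR_ge0// ler_expR ler_wpM2l//; last exact: S01k.
by rewrite !mulr_ge0// ltW.
Qed.

End kernel.

(** * Cutting a body orthogonally to a coordinate axis *)

Section cut.
Context {R : realType} {n : nat}.
Implicit Types (x : 'I_n -> R) (s t : R) (y z : n.-tuple R) (A S : set (n.-tuple R)).

(** The sign [e], equal to 1 or -1, lets one formula treat both directions of the axis. *)
Definition height x s (j : 'I_n) (e : R) y : R := e * ((tnth y j - x j) / s).

Definition above A x s j e t : set (n.-tuple R) := A `&` [set y | t < height x s j e y].
Definition below A x s j e t : set (n.-tuple R) := A `&` [set y | height x s j e y <= t].

Lemma measurable_height x s j e : measurable_fun setT (height x s j e).
Proof.
apply: measurable_funM; first exact: measurable_cst.
apply: measurable_funM; last exact: measurable_cst.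
by apply: measurable_funB; [exact: measurable_tnth|exact: measurable_cst].
Qed.

Lemma measurable_above A x s j e t : measurable A -> measurable (above A x s j e t).
Proof.
move=> mA; apply: measurableI => //.
rewrite (_ : [set y | _] = height x s j e @^-1` `]t, +oo[%classic); last first.
  by apply/seteqP; split=> y /=; rewrite in_itv/= andbT.
by rewrite -[X in measurable X]setTI; apply: measurable_height => //; exact: measurable_itv.
Qed.

Lemma measurable_below A x s j e t : measurable A -> measurable (below A x s j e t).
Proof.
move=> mA; apply: measurableI => //.
rewrite (_ : [set y | _] = height x s j e @^-1` `]-oo, t]%classic); last first.
  by apply/seteqP; split=> y /=; rewrite in_itv/=.
by rewrite -[X in measurable X]setTI; apply: measurable_height => //; exact: measurable_itv.
Qed.

Variable c : R.
Hypothesis c1 : 1 <= c.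

Section cut_fixed.
Variables (A : set (n.-tuple R)) (x : 'I_n -> R) (s : R) (j : 'I_n) (e : R).
Hypothesis mA : measurable A.
Hypothesis Ac : A `<=` cube c (n:=n).
Hypothesis s0 : 0 < s.
Hypothesis e1 : e ^+ 2 = 1.

Let mab t := measurable_above x s j e t mA.
Let mbe t := measurable_below x s j e t mA.

Lemma above_cube t : above A x s j e t `<=` cube c (n:=n).
Proof. by move=> y [/Ac]. Qed.

Lemma below_cube t : below A x s j e t `<=` cube c (n:=n).
Proof. by move=> y [/Ac]. Qed.

Lemma kernel_mass_cut t : kernel_mass x s A =
  kernel_mass x s (above A x s j e t) + kernel_mass x s (below A x s j e t).
Proof.
rewrite -(kernel_massU c1)//; [|exact: above_cube|exact: below_cube|]; last first.
  by apply/disj_setPS => y [[_ /= h1] [_ /=]]; rewrite leNgt h1.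
congr kernel_mass; apply/seteqP; split=> [y Ay|y [[]|[]]//].
by have [h|h] := leP (height x s j e y) t; [right|left].
Qed.

(** The layer between the two cuts lies in a box of width s (t' - t) along [j] and 2c along the
    other axes, and the kernel is at most 1. *)
Lemma kernel_mass_above_lip t t' : t <= t' ->
  kernel_mass x s (above A x s j e t) - kernel_mass x s (above A x s j e t') <=
  s * (\prod_(i < n | i != j) (c + c)) * (t' - t).
Proof.
move=> tt'; pose S := above (below A x s j e t') x s j e t.
have mS : measurable S by exact: measurable_above.
have Sc : S `<=` cube c (n:=n) by move=> y [[/Ac]].
have -> : above A x s j e t = above A x s j e t' `|` S.
  apply/seteqP; split=> [y [Ay ty]|y [[Ay /= t'y]|[[Ay _] ty]]].
  - by have [h|h] := leP (height x s j e y) t'; [right|left].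
  - by split=> //=; exact: le_lt_trans t'y.
  - by [].
rewrite (kernel_massU c1)//; [|exact: above_cube|]; last first.
  by apply/disj_setPS => y [[_ /= h1] [[_ /=]]]; rewrite leNgt h1.
rewrite addrC addKr.
(* Heights between [t] and [t'] mean that the j-th coordinate is within [r] of [m], for either sign
   [e]. *)
pose m := x j + e * s * ((t + t') / 2).
pose r := s * ((t' - t) / 2).
have r0 : 0 <= r by rewrite mulr_ge0 ?(ltW s0)// divr_ge0// subr_ge0.
pose l i := if i == j :> nat then m - r else - c.
pose u i := if i == j :> nat then m + r else c.
have lu i : l i <= u i.
  by rewrite /l /u; case: ifP => _; [rewrite lerD2l (le_trans _ r0)// oppr_le0|have := c1; lra].
have Slu : S `<=` box l u.
  move=> y [[Ay ht'] ht] i; rewrite /l /u; have [/val_inj ->|_] := eqVneq (i : nat) j; last exact: Ac.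
  rewrite -ler_distl.
  have -> : tnth y j - m = e * s * (height x s j e y - (t + t') / 2).
    rewrite /m /height mulrBr opprD addrA; congr (_ - _).
    rewrite mulrACA -expr2 e1 mul1r mulrCA divff ?mulr1// gt_eqF//.
  have en : `|e| = 1.
    by apply/eqP; rewrite -sqrp_eq1// real_normK ?num_real// e1.
  rewrite !normrM en mul1r (gtr0_norm s0) ler_pM2l// ler_norml.
  by move: ht' ht => /= ? ?; apply/andP; split; lra.
apply: le_trans (kernel_mass_box c1 x s mS Sc lu Slu) _.
rewrite (bigD1 j)//= (eq_bigr (fun=> c + c)); last first.
  by move=> i; rewrite -val_eqE /= => ij; rewrite /u /l (negbTE ij) opprK.
rewrite /u /l eqxx -mulrA mulrCA mulrC le_eqVlt; apply/orP; left; apply/eqP.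
by rewrite /r; field.
Qed.

Lemma kernel_mass_above_continuous : continuous (fun t => kernel_mass x s (above A x s j e t)).
Proof.
pose L := s * (\prod_(i < n | i != j) (c + c)).
have L0 : 0 <= L.
  by rewrite mulr_ge0 ?(ltW s0)//; apply: prodr_ge0 => i _; have := c1; lra.
have mono t t' : t <= t' ->
    kernel_mass x s (above A x s j e t') <= kernel_mass x s (above A x s j e t).
  move=> tt'; apply: (le_kernel_mass c1) => //; first exact: above_cube.
  by move=> y [Ay /= h]; split=> //=; exact: le_lt_trans h.
have lip t t' : `|kernel_mass x s (above A x s j e t) - kernel_mass x s (above A x s j e t')|
    <= L * `|t - t'|.
  have [tt'|/ltW tt'] := leP t t'.
    rewrite ger0_norm ?subr_ge0 ?mono// (distrC t) (@ger0_norm _ (t' - t)) ?subr_ge0//.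
    exact: kernel_mass_above_lip.
  rewrite distrC ger0_norm ?subr_ge0 ?mono// (@ger0_norm _ (t - t')) ?subr_ge0//.
  exact: kernel_mass_above_lip.
have L1 : 0 < L + 1 by rewrite ltr_wpDl.
move=> t; apply/cvgrPdist_lt => eps eps0; near=> t'.
apply: le_lt_trans (lip _ _) _.
apply: (@le_lt_trans _ _ ((L + 1) * `|t - t'|)); first by rewrite ler_wpM2r// lerDl.
rewrite -ltr_pdivlMl// mulrC.
near: t'; exists (eps / (L + 1)) => /=; [exact: divr_gt0|by []].
Unshelve. all: by end_near. Qed.

Lemma height_bounded y : cube c y ->
  `|height x s j e y| <= (c + `|x j|) / s.
Proof.
move=> yc; have en : `|e| = 1.
  by apply/eqP; rewrite -sqrp_eq1// real_normK ?num_real// e1.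
rewrite /height !normrM en mul1r normfV (gtr0_norm s0) ler_pM2r ?invr_gt0//.
apply: le_trans (ler_normB _ _) _; rewrite lerD2r.
by have := yc j; rewrite -ler_norml.
Qed.

Lemma kernel_mass_above_ivt v : 0 <= v <= kernel_mass x s A ->
  exists t, kernel_mass x s (above A x s j e t) = v.
Proof.
move=> /andP[v0 vA]; pose M := (c + `|x j|) / s.
have M0 : 0 <= M by rewrite divr_ge0 ?ltW//; have := normr_ge0 (x j); have := c1; lra.
(* Heights lie in [-M, M]. The cut is strict, so it must be below -M to keep all of A, while at M it
   is already empty. *)
have lowE : kernel_mass x s (above A x s j e (- M - 1)) = kernel_mass x s A.
  congr kernel_mass; apply/seteqP; split=> [y []//|y Ay]; split=> //=.
  by have /height_bounded := Ac Ay; rewrite ler_norml -/M => /andP[? _]; lra.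
have highE : kernel_mass x s (above A x s j e M) = 0.
  have -> : above A x s j e M = set0.
    apply/seteqP; split=> // y [Ay /=]; rewrite ltNge.
    by have /height_bounded := Ac Ay; rewrite ler_norml -/M => /andP[_ ->].
  rewrite /kernel_mass; under eq_Rintegral do rewrite indic0 mulr0.
  by rewrite /Rintegral integral0.
have [|||t _ tv] := @IVT R (fun t => kernel_mass x s (above A x s j e t)) (- M - 1) M v.
- by lra.
- by apply: continuous_subspaceT; exact: kernel_mass_above_continuous.
- by rewrite lowE highE ge_min le_max v0 vA orbT.
- by exists t.
Qed.

End cut_fixed.
End cut.

(** * Strictness for open convex bodies *)

Section strict.
Context {R : realType} {n : nat}.
Variables (c : R) (A : set (n.-tuple R)).
Hypothesis c1 : 1 <= c.
Hypothesis mA : measurable A.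
Hypothesis Ac : A `<=` cube c (n:=n).
Hypothesis A0 : A !=set0.
Hypothesis A_convex : forall a b y z, 0 < a -> 0 < b -> a + b = 1 ->
  A y -> A z -> A (comb a b y z).
Hypothesis A_open : forall y, A y -> exists2 d, 0 < d &
  forall z, (forall i, `|tnth z i - tnth y i| <= d) -> A z.

Let mass (x : 'I_n -> R) (s : R) := kernel_mass x s A / s ^+ n.

Lemma mass_gt0 x s : 0 < s -> 0 < mass x s.
Proof.
move=> s0; have [y Ay] := A0; have [d d0 yd] := A_open Ay.
by rewrite divr_gt0 ?exprn_gt0//; exact: (kernel_mass_gt0 c1 x s d0 mA Ac yd).
Qed.

(* Cutting both copies of [A] at heights leaving the same proportion [th] above
   separates the upper parts by a gap, in which the strict convexity of the
   square norm yields a factor [> 1]; the lower parts obey the plain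
   Prekopa-Leindler inequality. *)
Lemma mass_strict x0 x1 s0 s1 a b (j : 'I_n) e y1 M : 0 < s0 -> 0 < s1 ->
  0 < a -> 0 < b -> a + b = 1 -> e ^+ 2 = 1 ->
  (forall y, A y -> height x0 s0 j e y <= M) -> A y1 -> M < height x1 s1 j e y1 ->
  Num.min (mass x0 s0) (mass x1 s1) <
  mass (fun i => a * x0 i + b * x1 i) (a * s0 + b * s1).
Proof.
move=> s00 s10 a0 b0 ab e1 AM Ay1 My1.
pose s := a * s0 + b * s1.
have sgt0 : 0 < s by rewrite addr_gt0// mulr_gt0.
pose p := a * s0 / s; pose q := b * s1 / s.
have p0 : 0 < p by rewrite divr_gt0// mulr_gt0.
have q0 : 0 < q by rewrite divr_gt0// mulr_gt0.
have pq : p + q = 1 by rewrite /p /q -mulrDl divff// gt_eqF.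
have ps : p * s = a * s0 by rewrite /p mulfVK// gt_eqF.
have qs : q * s = b * s1 by rewrite /q mulfVK// gt_eqF.
pose xs i := a * x0 i + b * x1 i.
have heightE y z : height xs s j e (comb a b y z) =
    p * height x0 s0 j e y + q * height x1 s1 j e z.
  rewrite /height tnth_mktuple /xs /p /q; field; by rewrite !gt_eqF.
(* Above M, so that a gap t1 - M remains; below the height of [y1], so that the upper part has
   positive mass. *)
pose t1 := (M + height x1 s1 j e y1) / 2.
have Mt1 : M < t1 by rewrite /t1; lra.
have t1y : t1 < height x1 s1 j e y1 by rewrite /t1; lra.
have m1_gt0 : 0 < kernel_mass x1 s1 (above A x1 s1 j e t1).
  have [d d0 yd] := A_open Ay1.
  (* Within [d'] of [y1] a point stays in A and loses at most half of the excess of height over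
     [t1]. *)
  pose d' := Num.min d ((height x1 s1 j e y1 - t1) / 2 * s1).
  have d'0 : 0 < d' by rewrite lt_min d0 mulr_gt0// divr_gt0// subr_gt0.
  apply: (kernel_mass_gt0 c1 x1 s1 d'0 (y := y1)) => //.
  - exact: measurable_above.
  - exact: above_cube.
  - move=> z zd; split.
      by apply: yd => i; rewrite (le_trans (zd i))// ge_min lexx.
    rewrite /=; have := zd j; rewrite le_min => /andP[_].
    have -> : tnth z j - tnth y1 j = s1 * e * (height x1 s1 j e z - height x1 s1 j e y1).
      rewrite /height -mulrBr -mulrBl opprB addrA subrK [s1 * e]mulrC -!mulrA (mulrCA s1) (mulrA e e).
      by rewrite -expr2 e1 mul1r mulrC mulfVK// gt_eqF.
    have en : `|e| = 1.
      by apply/eqP; rewrite -sqrp_eq1// real_normK ?num_real// e1.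
    rewrite !normrM en mulr1 (gtr0_norm s10) mulrC ler_pM2r// ler_norml => /andP[? _].
    lra.
have K1 : kernel_mass x1 s1 (above A x1 s1 j e t1) <= kernel_mass x1 s1 A.
  by apply: (le_kernel_mass c1) => //; [exact: measurable_above|move=> y []].
have K0 := kernel_mass_ge0 x0 s0 A.
have [th [th0 th1 up1]] : exists th, [/\ 0 < th, th <= 1 &
    kernel_mass x1 s1 (above A x1 s1 j e t1) = th * kernel_mass x1 s1 A].
  move: m1_gt0 K1; move: (kernel_mass _ _ (above _ _ _ _ _ _)) (kernel_mass _ _ A).
  move=> u v u0 uv; have v0 := lt_le_trans u0 uv; exists (u / v).
  by rewrite divr_gt0// ler_pdivrMr// mul1r uv mulfVK// gt_eqF.
have lo1 : kernel_mass x1 s1 (below A x1 s1 j e t1) = (1 - th) * kernel_mass x1 s1 A.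
  by rewrite mulrBl mul1r -up1 [in RHS](kernel_mass_cut c1 x1 s1 j e mA Ac t1) addrC addKr.
have [t0 up0] : exists t, kernel_mass x0 s0 (above A x0 s0 j e t) = th * kernel_mass x0 s0 A.
  apply: (kernel_mass_above_ivt c1) => //.
  move: K0 th0 th1; clear; move: (kernel_mass _ _ _) => u u0 th0 th1.
  by rewrite mulr_ge0 ?(ltW th0)//= ler_piMl.
have lo0 : kernel_mass x0 s0 (below A x0 s0 j e t0) = (1 - th) * kernel_mass x0 s0 A.
  by rewrite mulrBl mul1r -up0 [in RHS](kernel_mass_cut c1 x0 s0 j e mA Ac t0) addrC addKr.
(* Heights combine with weights [p], [q], so this cut receives upper parts above and lower parts
   below. *)
pose t := p * t0 + q * t1.
have up := @prekopa_leindler_kernel R n c c1 x0 x1 s0 s1 s a b p q ((t1 - M) ^+ 2)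
  (above A x0 s0 j e t0) (above A x1 s1 j e t1) (above A xs s j e t)
  a0 b0 p0 q0 s00 s10 sgt0 pq ps qs (sqr_ge0 _) (measurable_above _ _ _ _ _ mA)
  (measurable_above _ _ _ _ _ mA) (measurable_above _ _ _ _ _ mA)
  (@above_cube R n c A _ _ _ _ Ac _) (@above_cube R n c A _ _ _ _ Ac _) (@above_cube R n c A _ _ _ _ Ac _).
have lo := @prekopa_leindler_kernel R n c c1 x0 x1 s0 s1 s a b p q 0
  (below A x0 s0 j e t0) (below A x1 s1 j e t1) (below A xs s j e t)
  a0 b0 p0 q0 s00 s10 sgt0 pq ps qs (lexx 0) (measurable_below _ _ _ _ _ mA)
  (measurable_below _ _ _ _ _ mA) (measurable_below _ _ _ _ _ mA)
  (@below_cube R n c A _ _ _ _ Ac _) (@below_cube R n c A _ _ _ _ Ac _) (@below_cube R n c A _ _ _ _ Ac _).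
pose G := mass x0 s0 `^ p * mass x1 s1 `^ q.
have G0 : 0 < G by rewrite mulr_gt0 ?powR_gt0 ?mass_gt0.
(* A common proportion factors out because r^p r^q = r. The value r = 1 - th may be 0, and both
   sides are then 0. *)
have scale r : 0 <= r ->
    (r * kernel_mass x0 s0 A / s0 ^+ n) `^ p * (r * kernel_mass x1 s1 A / s1 ^+ n) `^ q = r * G.
  rewrite /G -!(mulrA r); move: (mass_gt0 x0 s00) (mass_gt0 x1 s10) p0 q0 pq; rewrite /mass.
  move: (kernel_mass x0 s0 A / _) (kernel_mass x1 s1 A / _) (p) (q); clear.
  move=> u v p q u0 v0 p0 q0 pq r0; rewrite !powRM ?(ltW u0) ?(ltW v0)// mulrACA.
  have [->|rn0] := eqVneq r 0; first by rewrite powR0 ?gt_eqF// !mul0r.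
  by rewrite -powRD ?pq ?powRr1// rn0 implybT.
rewrite up0 up1 scale ?(ltW th0)// in up.
rewrite lo0 lo1 scale ?subr_ge0// mulr0 expR0 mul1r in lo.
apply: (@le_lt_trans _ _ G).
  pose m := Num.min (mass x0 s0) (mass x1 s1).
  have m0 : 0 < m by rewrite lt_min !mass_gt0.
  have {1}-> : Num.min (mass x0 s0) (mass x1 s1) = m `^ p * m `^ q.
    by rewrite -powRD ?pq ?powRr1// ?(ltW m0)// (gt_eqF m0) implybT.
  apply: ler_pM; rewrite ?powR_ge0//; apply: ge0_ler_powR;
    by rewrite ?nnegrE ?(ltW p0) ?(ltW q0) ?(ltW m0) ?(ltW (mass_gt0 _ _))// ge_min lexx ?orbT.
rewrite -/s -/xs {1}/mass (kernel_mass_cut c1 xs s j e mA Ac t) mulrDl.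
apply: lt_le_trans (lerD (up _ _) (lo _ _)); last 4 first.
- move=> y z [Ay /= yt] [Az /= zt]; split; first exact: A_convex.
  by rewrite /= heightE /t ltrD// ltr_pM2l.
- move=> y z [Ay /= yt] [Az /= zt].
  (* The j-th coordinate alone provides the distance: [z] is above [t1], while every point of the
     first body has height at most M. *)
  apply: (@le_trans _ _ ((height x1 s1 j e z - height x0 s0 j e y) ^+ 2)).
    have gap := lerB (ltW zt) (AM _ Ay).
    by rewrite lerXn2r ?nnegrE// ?(le_trans _ gap)// subr_ge0 ltW.
  rewrite (bigD1 j)//= /height -mulrBr exprMn e1 mul1r -sqrrN opprB lerDl.
  by apply: sumr_ge0 => i _; exact: sqr_ge0.
- move=> y z [Ay /= yt] [Az /= zt]; split; first exact: A_convex.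
  by rewrite /= heightE /t lerD// ler_pM2l.
- by move=> y z _ _; apply: sumr_ge0 => i _; exact: sqr_ge0.
(* With this factor E, the sum of the two estimates exceeds G by (E - 1) th G. *)
have E1 : 1 < expR (p * q / 4 * (t1 - M) ^+ 2).
  by rewrite -expR0 ltr_expR !mulr_gt0 ?subr_gt0// invr_gt0.
have := mulr_gt0 th0 G0; rewrite -subr_gt0 => H1.
rewrite -subr_gt0.
have -> : expR (p * q / 4 * (t1 - M) ^+ 2) * (th * G) + (1 - th) * G - G =
  (expR (p * q / 4 * (t1 - M) ^+ 2) - 1) * (th * G) by ring.
by rewrite mulr_gt0 ?subr_gt0// mulr_gt0.
Qed.

Let support (j : 'I_n) (e : R) := sup [set e * tnth y j | y in A].

Lemma has_sup_support j e : e ^+ 2 = 1 -> has_sup [set e * tnth y j | y in A].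
Proof.
move=> e1; split; first by have [y Ay] := A0; exists (e * tnth y j), y.
exists c => _ [y Ay <-]; apply: le_trans (ler_norm _) _.
have en : `|e| = 1.
  by apply/eqP; rewrite -sqrp_eq1// real_normK ?num_real// e1.
by rewrite normrM en mul1r ler_norml; exact: Ac.
Qed.

(** The sum is the width of A along [j]; it is cancelled below to compare [s0] with [s1]. *)
Lemma support_width_gt0 j : 0 < support j 1 + support j (-1).
Proof.
have [y Ay] := A0; have [d d0 yd] := A_open Ay.
pose z := [tuple tnth y i + d | i < n].
have Az : A z by apply: yd => i; rewrite tnth_mktuple addrC addKr gtr0_norm.
have s1 : 1 * tnth z j <= support j 1.
  by apply: ub_le_sup; [apply: (has_sup_support _ _).2; rewrite expr1n|exists z].
have s2 : -1 * tnth y j <= support j (-1).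
  by apply: ub_le_sup; [apply: (has_sup_support _ _).2; rewrite sqrrN expr1n|exists y].
move: s1 s2; rewrite tnth_mktuple => s1 s2.
apply: lt_le_trans (lerD s1 s2).
by rewrite mul1r mulN1r addrAC subrr add0r.
Qed.

Lemma heightE (x : 'I_n -> R) s j e (y : n.-tuple R) : height x s j e y = (e * tnth y j - e * x j) / s.
Proof. by rewrite /height mulrA mulrBr. Qed.

(** Each side is the supremum of the heights of one body. The hypothesis is what remains when the
    situation of [mass_strict] is excluded. *)
Lemma support_le x0 x1 s0 s1 j e : 0 < s0 -> 0 < s1 -> e ^+ 2 = 1 ->
  (forall M, (forall y, A y -> height x0 s0 j e y <= M) ->
    forall y, A y -> height x1 s1 j e y <= M) ->
  (support j e - e * x1 j) / s1 <= (support j e - e * x0 j) / s0.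
Proof.
move=> s00 s10 e1 h01; have hs := has_sup_support j e1.
rewrite ler_pdivrMr// lerBlDr; apply: ge_sup; first exact: hs.1.
move=> _ [y Ay <-]; rewrite -lerBlDr -ler_pdivrMr// -heightE; apply: h01 => // z Az.
rewrite heightE ler_pM2r ?invr_gt0// lerB//.
by apply: ub_le_sup; [exact: hs.2|exists z].
Qed.

Lemma mass_strict_neq x0 x1 s0 s1 a b : (0 < n)%N -> 0 < s0 -> 0 < s1 ->
  0 < a -> 0 < b -> a + b = 1 -> ~ (x0 =1 x1 /\ s0 = s1) ->
  Num.min (mass x0 s0) (mass x1 s1) <
  mass (fun i => a * x0 i + b * x1 i) (a * s0 + b * s1).
Proof.
move=> n0 s00 s10 a0 b0 ab neq; apply: contrapT => nlt; apply: neq.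
have sup_eq j e : e ^+ 2 = 1 ->
    (support j e - e * x1 j) / s1 = (support j e - e * x0 j) / s0.
  move=> e1; apply/eqP; rewrite eq_le !support_le// => M hM y Ay;
    rewrite leNgt; apply/negP => My; apply: nlt.
    (* One of the two comparisons needs the bodies exchanged, hence also the weights. *)
    rewrite minC [X in _ < mass X _](_ : _ = fun i => b * x1 i + a * x0 i); last first.
      by apply/funext => i; rewrite addrC.
    rewrite (addrC (a * s0)).
    by apply: (mass_strict s10 s00 b0 a0 _ e1 hM Ay My);
      rewrite addrC.
  exact: (mass_strict s00 s10 a0 b0 ab e1 hM Ay My).
have sN1 : (-1 : R) ^+ 2 = 1 by rewrite sqrrN expr1n.
have s01 : s0 = s1.
  pose j := Ordinal n0; have w0 := support_width_gt0 j.
  (* Adding the equations for the two signs eliminates the j-th coordinates of [x0] and [x1]. *)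
  have : (support j 1 + support j (-1)) / s1 = (support j 1 + support j (-1)) / s0.
    have := sup_eq j (-1) sN1; have := sup_eq j 1 (expr1n _ _).
    rewrite !mul1r !mulN1r !opprK => eq1 eq2.
    have split_at x s : (support j 1 + support j (-1)) / s =
        (support j 1 - x) / s + (support j (-1) + x) / s.
      by rewrite -mulrDl addrACA addNr addr0.
    by rewrite (split_at (x1 j)) (split_at (x0 j)) eq1 eq2.
  move/(mulfI (lt0r_neq0 w0)) => /invr_inj; exact: esym.
split=> // j; have := sup_eq j 1 (expr1n _ _); rewrite s01.
have s1n : s1^-1 != 0 by rewrite invr_eq0 gt_eqF.
by move/(mulIf s1n)/addrI/oppr_inj; rewrite !mul1r.
Qed.

End strict.

(** * The Gauss-Weierstrass integral *)

Section row_topology.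
Context {R : realType} {n : nat}.
Implicit Types (x : 'rV[R]_n) (y z : n.-tuple R) (P : set 'rV[R]_n).

Lemma nbhs_rowP x P : nbhs x P <->
  exists2 d, 0 < d & forall x', (forall i, `|x' ord0 i - x ord0 i| < d) -> P x'.
Proof.
split=> [/nbhs_ballP[d /= d0 xdP]|[d d0 xdP]].
  exists d => // x' x'x; apply: xdP; split=> // i j.
  by rewrite (ord1 i) -ball_normE /= distrC.
apply/nbhs_ballP; exists d => //= x' [_ xx']; apply: xdP => i.
by have := xx' ord0 i; rewrite -ball_normE /= distrC.
Qed.

Lemma nbhs_row_of_tuple y P : nbhs (row_of_tuple y) P ->
  exists2 d, 0 < d & forall z, (forall i, `|tnth z i - tnth y i| <= d) ->
    P (row_of_tuple z).
Proof.
move=> /nbhs_rowP[d d0 ydP]; exists (d / 2); first by rewrite divr_gt0.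
move=> z zy; apply: ydP => i; rewrite !mxE (le_lt_trans (zy i))//.
by rewrite ltr_pdivrMr// ltr_pMr// ltr1n.
Qed.

Lemma row_coord_le_norm x i : `|x ord0 i| <= `|x|.
Proof. by rewrite {2}/Num.norm/= mx_normrE; exact: (le_bigmax _ _ (ord0, i)). Qed.

(** This links the sup-norm topology of rows with the product sigma-algebra of tuples: an open set
    is the union of the countably many cubes with rational centre and half-side 1 / (k + 1) that it
    contains. *)
Lemma measurable_row_preimage_open P : open P ->
  measurable (@row_of_tuple R n @^-1` P : set (n.-tuple R)).
Proof.
move=> oP.
pose Q (v : n.-tuple rat * nat) : set (n.-tuple R) :=
  box (fun i => ratr (nth 0 v.1 i) - v.2.+1%:R^-1) (fun i => ratr (nth 0 v.1 i) + v.2.+1%:R^-1).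
pose F v := if `[< Q v `<=` @row_of_tuple R n @^-1` P >] then Q v else set0.
rewrite (_ : _ @^-1` P = \bigcup_v F v).
  apply: countable_bigcupT_measurable; first exact: countableP.
  by move=> v; rewrite /F; case: ifP => _; [exact: measurable_box|exact: measurable0].
apply/seteqP; split=> [y Py|y [v _]]; last first.
  by rewrite /F; case: asboolP => // vP /vP.
have [d d0 yd] : exists2 d, 0 < d & forall z, (forall i, `|tnth z i - tnth y i| <= d) ->
    P (row_of_tuple z).
  by apply: nbhs_row_of_tuple; move: oP; rewrite openE; exact.
(* Two points of such a cube differ by at most 2 / (k + 1) < d in each coordinate. *)
have [k] : exists k, 0 + k.+1%:R^-1 < d / 2 by apply: ltr_add_invr; rewrite divr_gt0.
rewrite add0r => kd.
have /choice[q qE] : forall i : 'I_n, exists q : rat, `|tnth y i - ratr q| <= k.+1%:R^-1.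
  move=> i; have [|q] := @rat_in_itvoo R (tnth y i - k.+1%:R^-1) (tnth y i + k.+1%:R^-1).
    by rewrite ltrD2l -subr_gt0 opprK addr_gt0.
  rewrite in_itv/= => /andP[q1 q2]; exists q; rewrite ler_distl.
  by rewrite lerBlDr (ltW q2) -lerBlDr (ltW q1).
exists ([tuple q i | i < n], k) => //.
have nthq (i : 'I_n) : nth 0 [tuple q i | i < n] i = q i.
  by rewrite -tnth_nth tnth_mktuple.
rewrite /F; case: asboolP; last first.
  case=> z zQ; apply: yd => i; have /= := zQ i; rewrite nthq.
  rewrite -ler_distl => zq; have := qE i; rewrite distrC => qy.
  rewrite -(subrKA (ratr (q i))) (le_trans (ler_normD _ _))// (le_trans (lerD zq qy))//.
  by rewrite (splitr d) ltW// ltrD.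
by move=> _ i /=; rewrite nthq -ler_distl.
Qed.

Lemma measurable_row_preimage_closed P : closed P ->
  measurable (@row_of_tuple R n @^-1` P : set (n.-tuple R)).
Proof.
move=> cP; rewrite -[X in measurable X]setCK; apply: measurableC.
by apply: (@measurable_row_preimage_open (~` P)); exact: closed_openC.
Qed.

End row_topology.

(** * Closure and interior of a bounded convex set *)

Section convex_rows.
Context {R : realType} {n : nat}.
Variable (Omega : set 'rV[R]_n).

Lemma bounded_closure_cube : bounded_set Omega -> exists2 c : R, 1 <= c &
  @row_of_tuple R n @^-1` closure Omega `<=` cube c (n:=n).
Proof.
move=> [M [_ OM]]; pose M1 := Num.max M 0 + 1.
have M1P x : Omega x -> `|x| <= M1.
  by apply: OM; rewrite /M1 ltr_pwDr// le_max lexx.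
have M10 : 0 < M1 by rewrite /M1 ltr_pwDr// le_max lexx orbT.
(* The added 1 pays for approximating a point of the closure by a point of Omega, and ensures 1 <=
   c. *)
exists (M1 + 1); first by rewrite lerDr ltW.
move=> y /(_ [set x' | forall i, `|x' ord0 i - tnth y i| < 1])[].
  by apply/nbhs_rowP; exists 1 => // x' h i; have := h i; rewrite mxE.
move=> x [Ox xy] i; rewrite -ler_norml.
rewrite -(subrK (x ord0 i) (tnth y i)) (le_trans (ler_normD _ _))// addrC lerD//.
  exact: le_trans (row_coord_le_norm _ _) (M1P _ Ox).
by rewrite distrC ltW.
Qed.

Hypothesis Omega_convex : convex_set Omega.

Lemma convex_set_segment a b x x' : 0 <= a -> 0 <= b -> a + b = 1 ->
  Omega x -> Omega x' -> Omega (a *: x + b *: x').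
Proof.
move=> a0 b0 ab Ox Ox'.
have a1 : a <= 1 by rewrite -ab lerDl.
have /set_mem := @Omega_convex x x' (Itv01 a0 a1) (mem_set Ox) (mem_set Ox').
rewrite /conv/=; congr (Omega (_ + _ *: _)).
by rewrite /unstable.onem -ab addrC addKr.
Qed.

(** Replace [x] by a nearby [z] in Omega. A point [w] near a x + b x' is then a z + b w' with w' =
    (w - a z) / b, which is close enough to x' to lie in Omega. *)
Lemma interior_segment a b x x' : 0 < a -> 0 < b -> a + b = 1 ->
  closure Omega x -> Omega° x' -> Omega° (a *: x + b *: x').
Proof.
move=> a0 b0 ab cx /nbhs_rowP[d d0 x'd].
(* The errors from [w] and from [z] are each below b d / 2, so dividing their sum by [b] stays below
   [d]. *)
have be0 : 0 < b * d / 2 by rewrite divr_gt0// mulr_gt0.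
have [|z [Oz zx]] := cx [set x' | forall i, `|x' ord0 i - x ord0 i| < b * d / 2].
  by apply/nbhs_rowP; exists (b * d / 2).
apply/nbhs_rowP; exists (b * d / 2) => // w wx.
have -> : w = a *: z + b *: (b^-1 *: (w - a *: z)).
  by rewrite scalerA divff ?gt_eqF// scale1r addrC subrK.
apply: convex_set_segment => //; [exact: ltW|exact: ltW|].
apply: x'd => i; have := wx i; have := zx i; rewrite /= !mxE => zi wi.
have -> : b^-1 * (w ord0 i - a * z ord0 i) - x' ord0 i =
  b^-1 * ((w ord0 i - (a * x ord0 i + b * x' ord0 i)) - a * (z ord0 i - x ord0 i)).
  by field; rewrite gt_eqF.
rewrite normrM gtr0_norm ?invr_gt0// mulrC ltr_pdivrMr//.
apply: le_lt_trans (ler_normB _ _) _.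
have -> : d * b = b * d / 2 + b * d / 2 by field.
apply: ltrD => //; rewrite normrM gtr0_norm//; apply: le_lt_trans zi.
by rewrite ler_piMl// -ab lerDl ltW.
Qed.

Lemma row_of_tuple_comb a b (y z : n.-tuple R) :
  row_of_tuple (comb a b y z) = a *: row_of_tuple y + b *: row_of_tuple z.
Proof. by apply/rowP => i; rewrite !mxE tnth_mktuple. Qed.

End convex_rows.

(** The integral of a nonnegative function is a supremum over simple functions below it, hence
    monotone without measurability. This is what permits the squeeze of the indicator of Omega. *)
Lemma le_integral_nonmeasurable d (T : measurableType d) (R : realType)
    (mu : {measure set T -> \bar R}) (f g : T -> \bar R) :
  (forall x, 0 <= f x)%E -> (forall x, f x <= g x)%E ->
  (\int[mu]_x f x <= \int[mu]_x g x)%E.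
Proof.
move=> f0 fg; have g0 x : (0 <= g x)%E by exact: le_trans (fg x).
rewrite !ge0_integralTE//; apply: ereal_sup_le => _ [h hf <-]; exists h => //= x.
exact: le_trans (fg x).
Qed.

Section completion.
Context {R : realType} {n : nat}.

(** The identity from Caratheodory measurable sets to Borel sets is measurable and pushes the
    completed measure to the Borel one. *)
Lemma integral_lebesgue_Rn (f : n.-tuple R -> \bar R) :
  measurable_fun setT f -> (forall y, 0 <= f y)%E ->
  (\int[@lebesgue_Rn R n]_y f y = \int[@borel_lebesgue R n]_y f y)%E.
Proof.
move=> mf f0.
pose C := caratheodory_type ((@borel_lebesgue R n)^*)%mu.
pose i : C -> n.-tuple R := idfun.
have mi : measurable_fun setT i.
  by move=> _ Y mY; rewrite setTI; exact: caratheodory_measurable_mu_ext.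
rewrite -[LHS](ge0_integral_pushforward mi (@lebesgue_Rn R n) measurableT mf)//.
apply: eq_measure_integral => S mS _.
exact: measurable_mu_extE.
Qed.

End completion.

(** * Reduction of the Gauss-Weierstrass integral to a Gaussian mass *)

Section gauss_weierstrass_kernel.
Context {R : realType} {n : nat}.
Variable Omega : set 'rV[R]_n.
Hypothesis Omega_bounded : bounded_set Omega.
Hypothesis Omega_convex : convex_set Omega.
Hypothesis Omega_interior : Omega° !=set0.

Definition tuple_interior : set (n.-tuple R) := @row_of_tuple R n @^-1` Omega°.
Definition tuple_closure : set (n.-tuple R) := @row_of_tuple R n @^-1` closure Omega.

Lemma measurable_tuple_interior : measurable tuple_interior.
Proof. by apply: measurable_row_preimage_open; exact: open_interior. Qed.

Lemma measurable_tuple_closure : measurable tuple_closure.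
Proof. by apply: measurable_row_preimage_closed; exact: closed_closure. Qed.

Lemma tuple_interiorS : tuple_interior `<=` tuple_closure.
Proof. by move=> y /interior_subset; exact: subset_closure. Qed.

Lemma tuple_interior_neq0 : tuple_interior !=set0.
Proof.
have [x xO] := Omega_interior; exists [tuple x ord0 i | i < n].
rewrite /tuple_interior/=; have -> : row_of_tuple [tuple x ord0 i | i < n] = x; last by [].
by apply/rowP => i; rewrite mxE tnth_mktuple.
Qed.

Lemma tuple_interior_open y : tuple_interior y -> exists2 d, 0 < d &
  forall z, (forall i, `|tnth z i - tnth y i| <= d) -> tuple_interior z.
Proof. by move=> yO; apply: nbhs_row_of_tuple; apply: nbhs_interior. Qed.

Lemma tuple_segment a b y z : 0 < a -> 0 < b -> a + b = 1 ->
  tuple_closure y -> tuple_interior z -> tuple_interior (comb a b y z).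
Proof.
move=> a0 b0 ab yO zO; rewrite /tuple_interior/= row_of_tuple_comb.
exact: interior_segment.
Qed.

(* The boundary is negligible: [comb 1/2 1/2] maps closure x interior into the
   interior, so Prekopa-Leindler gives sqrt (m closure * m interior) <= m interior. *)
Lemma kernel_mass_closure (x : 'I_n -> R) s : 0 < s ->
  kernel_mass x s tuple_closure = kernel_mass x s tuple_interior.
Proof.
move=> s0; have [c c1 cO] := bounded_closure_cube Omega_bounded.
have iO := subset_trans tuple_interiorS cO.
have mi := measurable_tuple_interior; have mc := measurable_tuple_closure.
apply/eqP; rewrite eq_le (le_kernel_mass c1 x s mi mc cO tuple_interiorS) andbT.
have [y yO] := tuple_interior_neq0; have [d d0 yd] := tuple_interior_open yO.
have i0 := kernel_mass_gt0 c1 x s d0 mi iO yd.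
have h0 : 0 < 2^-1 :> R by rewrite invr_gt0.
have hh : 2^-1 + 2^-1 = 1 :> R by rewrite [RHS]splitr mul1r.
have := @prekopa_leindler_kernel R n c c1 x x s s s 2^-1 2^-1 2^-1 2^-1 0
  tuple_closure tuple_interior tuple_interior h0 h0 h0 h0 s0 s0 s0 hh erefl erefl
  (lexx 0) mc mi mi cO iO iO.
rewrite mulr0 expR0 mul1r => PL.
have {PL} := PL (fun y z => tuple_segment h0 h0 hh)
  (fun y z _ _ => sumr_ge0 _ (fun i _ => sqr_ge0 _)).
have -> : (fun i => 2^-1 * x i + 2^-1 * x i) = x.
  by apply/funext => i; rewrite -mulrDl hh mul1r.
have sn0 : 0 < s ^+ n by rewrite exprn_gt0.
have u0 := kernel_mass_ge0 x s tuple_closure.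
move: i0 u0; move: (kernel_mass x s tuple_interior) (kernel_mass x s tuple_closure).
move=> v u v0 u0; rewrite !powR12_sqrt ?divr_ge0 ?(ltW sn0) ?(ltW v0)//.
(* One positive factor, the square root of the interior mass, now cancels on both sides. *)
have {2}-> : v / s ^+ n = Num.sqrt (v / s ^+ n) * Num.sqrt (v / s ^+ n).
  by rewrite -expr2 sqr_sqrtr// divr_ge0// ltW.
have us0 : 0 <= u / s ^+ n by rewrite divr_ge0// ltW.
have vs0 : 0 <= v / s ^+ n by rewrite divr_ge0// ltW.
rewrite ler_pM2r ?sqrtr_gt0 ?divr_gt0// ler_psqrt ?nnegrE//.
by rewrite ler_pM2r// invr_gt0.
Qed.

Lemma gauss_weierstrass_indic (x : 'rV[R]_n) t : 0 < t ->
  gauss_weierstrass (\1_Omega : 'rV[R]_n -> R) x t =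
  ((4 * pi) `^ (n%:R / 2))^-1 *
  (kernel_mass (fun i => x ord0 i) (Num.sqrt t) tuple_interior / Num.sqrt t ^+ n).
Proof.
move=> t0; have s0 : 0 < Num.sqrt t by rewrite sqrtr_gt0.
have pi0 := pi_gt0 R.
rewrite /gauss_weierstrass.
have -> : (4 * pi * t) `^ (n%:R / 2) = (4 * pi) `^ (n%:R / 2) * Num.sqrt t ^+ n.
  rewrite powRM ?mulr_ge0 ?(ltW pi0) ?(ltW t0)//; congr (_ * _).
  rewrite -[in LHS](sqr_sqrtr (ltW t0)) -powR_mulrn ?sqrtr_ge0// -powRrM.
  by rewrite mulrC divfK// powR_mulrn ?sqrtr_ge0.
rewrite invfM -mulrA [Num.sqrt t ^- n * _]mulrC.
congr (_ * (_ / _)).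
pose k (S : set (n.-tuple R)) y : \bar R :=
  (kernel (fun i => x ord0 i) (Num.sqrt t) y * \1_S y)%:E.
have kE y : expR (- (eucl_norm (x - row_of_tuple y) ^+ 2 / (4 * t))) =
    kernel (fun i => x ord0 i) (Num.sqrt t) y.
  rewrite /kernel/eucl_norm sqr_sqrtr; last by apply: sumr_ge0 => i _; exact: sqr_ge0.
  congr (expR (- _)); rewrite mulr_suml; apply: eq_bigr => i _.
  rewrite !mxE expr_div_n sqr_sqrtr ?(ltW t0)// -sqrrN opprB invfM mulrA.
  by rewrite mulrAC.
have k0 S y : (0 <= k S y)%E by rewrite lee_fin mulr_ge0// expR_ge0.
have mk S : measurable S -> measurable_fun setT (k S).
  move=> mS; apply/measurable_EFinP; apply: measurable_funM.
    exact: measurable_kernel.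
  exact: measurable_indic.
have kS (S : set 'rV[R]_n) (T : set (n.-tuple R)) y :
    (T y -> S (row_of_tuple y)) -> (k T y <= (kernel (fun i => x ord0 i) (Num.sqrt t) y * \1_S (row_of_tuple y))%:E)%E.
  move=> TS; rewrite lee_fin ler_wpM2l ?expR_ge0// !indicE ler_nat.
  by case: (boolP (y \in T)) => // /set_mem/TS/mem_set ->.
have Sk (S : set 'rV[R]_n) (T : set (n.-tuple R)) y :
    (S (row_of_tuple y) -> T y) -> ((kernel (fun i => x ord0 i) (Num.sqrt t) y * \1_S (row_of_tuple y))%:E <= k T y)%E.
  move=> ST; rewrite lee_fin ler_wpM2l ?expR_ge0// !indicE ler_nat.
  by case: (boolP (row_of_tuple y \in S)) => // /set_mem/ST/mem_set ->.
have [c c1 cO] := bounded_closure_cube Omega_bounded.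
have iO := subset_trans tuple_interiorS cO.
have mi := measurable_tuple_interior; have mc := measurable_tuple_closure.
have kI S : measurable S -> S `<=` cube c (n:=n) ->
    (\int[@lebesgue_Rn R n]_y k S y =
     (kernel_mass (fun i => x ord0 i) (Num.sqrt t) S)%:E)%E.
  move=> mS Sc; rewrite integral_lebesgue_Rn//; last exact: mk.
  by rewrite EFin_Rintegral//; exact: tame_integrable (tame_kernel c1 _ _ mS Sc).
rewrite /Rintegral; under eq_integral do rewrite kE.
rewrite -[RHS]/(fine (kernel_mass (fun i => x ord0 i) (Num.sqrt t) tuple_interior)%:E).
congr fine.
(* Omega lies between its interior and its closure, whose masses agree by [kernel_mass_closure]. *)
apply/eqP; rewrite eq_le; apply/andP; split.
  rewrite -kernel_mass_closure// -kI//.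
  apply: le_integral_nonmeasurable => y; first by rewrite lee_fin mulr_ge0// expR_ge0.
  by apply: Sk; exact: subset_closure.
rewrite -kI//; apply: le_integral_nonmeasurable => // y.
by apply: kS; exact: interior_subset.
Qed.

End gauss_weierstrass_kernel.

Lemma gauss_weierstrass_strict (R : realType) (n : nat) (n_gt0 : (0 < n)%N)
    (Omega : set 'rV[R]_n) (Omega_bounded : bounded_set Omega)
    (Omega_convex : convex_set Omega) (Omega_interior : Omega° !=set0)
    (x0 x1 : 'rV[R]_n) (t0 t1 l : R) :
  0 < t0 -> 0 < t1 -> 0 < l < 1 -> (x0, t0) <> (x1, t1) ->
  Num.min (gauss_weierstrass (\1_Omega : 'rV[R]_n -> R) x0 t0)
          (gauss_weierstrass (\1_Omega : 'rV[R]_n -> R) x1 t1) <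
  gauss_weierstrass (\1_Omega : 'rV[R]_n -> R) ((1 - l) *: x0 + l *: x1) (mean_half t0 t1 l).
Proof.
move=> t00 t10 /andP[l0 l1] neq.
have l1' : 0 < 1 - l by rewrite subr_gt0.
have [s00 s10] : 0 < Num.sqrt t0 /\ 0 < Num.sqrt t1 by rewrite !sqrtr_gt0.
have s0 : 0 < (1 - l) * Num.sqrt t0 + l * Num.sqrt t1 by rewrite addr_gt0// mulr_gt0.
have ts : 0 < mean_half t0 t1 l by rewrite /mean_half exprn_gt0.
rewrite !gauss_weierstrass_indic// -minr_pMr; last first.
  by rewrite invr_ge0 powR_ge0.
rewrite ltr_pM2l ?invr_gt0 ?powR_gt0 ?mulr_gt0 ?pi_gt0//.
(* The root of the mean time is (1 - l) s0 + l s1, the scale at which [mass_strict_neq] applies with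
   a = 1 - l and b = l. *)
rewrite /mean_half sqrtr_sqr gtr0_norm//.
have [c c1 cO] := bounded_closure_cube Omega_bounded.
have iO := subset_trans (@tuple_interiorS _ _ Omega) cO.
have -> : (fun i => ((1 - l) *: x0 + l *: x1) ord0 i) =
    (fun i => (1 - l) * x0 ord0 i + l * x1 ord0 i).
  by apply/funext => i; rewrite !mxE.
apply: (mass_strict_neq c1 (measurable_tuple_interior Omega) iO
  (tuple_interior_neq0 Omega_interior) _ (@tuple_interior_open _ _ Omega) n_gt0 s00 s10 l1' l0).
- move=> a b y z a0 b0 ab yO; apply: tuple_segment a0 b0 ab _ => //.
  exact: tuple_interiorS.
- by rewrite subrK.
- move=> [x01 s01]; apply: neq; congr pair; first exact/rowP.
  by rewrite -(sqr_sqrtr (ltW t00)) s01 sqr_sqrtr// ltW.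
Qed.

Lemma mean_half0 (R : realType) (t0 t1 : R) : 0 < t0 -> mean_half t0 t1 0 = t0.
Proof. by move=> t0_gt0; rewrite /mean_half subr0 mul1r mul0r addr0 sqr_sqrtr// ltW. Qed.

Lemma mean_half1 (R : realType) (t0 t1 : R) : 0 < t1 -> mean_half t0 t1 1 = t1.
Proof. by move=> t1_gt0; rewrite /mean_half subrr mul0r mul1r add0r sqr_sqrtr// ltW. Qed.

Lemma mean_halfxx (R : realType) (t l : R) : 0 < t -> mean_half t t l = t.
Proof. by move=> t_gt0; rewrite /mean_half -mulrDl subrK mul1r sqr_sqrtr// ltW. Qed.

(** For l = 0, l = 1 or equal points, the intermediate value is the value at an endpoint, so the
    weak inequality is immediate; elsewhere it follows from the strict one. *)
Lemma strictly_half_parabolically_quasi_concaveP (R : realType) (n : nat)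
    (phi : 'rV[R]_n -> R -> R) :
  (forall x t, 0 < t -> 0 <= phi x t) ->
  (forall (x0 x1 : 'rV[R]_n) (t0 t1 l : R),
    0 < t0 -> 0 < t1 -> 0 < l < 1 -> (x0, t0) <> (x1, t1) ->
    Num.min (phi x0 t0) (phi x1 t1) <
      phi ((1 - l) *: x0 + l *: x1) (mean_half t0 t1 l)) ->
  strictly_half_parabolically_quasi_concave phi.
Proof.
move=> phi0 strict; split=> //; split=> // x0 x1 t0 t1 l t00 t10 /andP[l0 l1].
have [->|ln0] := eqVneq l 0.
  by rewrite mean_half0// subr0 scale1r scale0r addr0 ge_min lexx.
have [->|ln1] := eqVneq l 1.
  by rewrite mean_half1// subrr scale1r scale0r add0r ge_min lexx orbT.
have [[<- <-]|neq] := pselect ((x0, t0) = (x1, t1)).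
  by rewrite mean_halfxx// -scalerDl subrK scale1r ge_min lexx.
by rewrite ltW// strict// !lt_neqAle l0 l1 ln1 eq_sym ln0.
Qed.

Unset Implicit Arguments.

Theorem proposition3p12 (R : realType) (n : nat) (n_gt0 : (0 < n)%N)
    (Omega : set 'rV[R]_n)
    (Omega_bounded : bounded_set Omega)
    (Omega_convex : convex_set Omega)
    (Omega_interior : Omega° !=set0) :
  strictly_half_parabolically_quasi_concave
    (gauss_weierstrass (\1_Omega : 'rV[R]_n -> R)).
Proof.
apply: strictly_half_parabolically_quasi_concaveP => [x t t0|x0 x1 t0 t1 l].
  rewrite mulr_ge0 ?invr_ge0 ?powR_ge0//; apply: Rintegral_ge0 => y _.
  by rewrite mulr_ge0// expR_ge0.
exact: gauss_weierstrass_strict.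
Qed.
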